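(* Let $p>0$, $p\neq 1$, let $D$ be a domain of the real plane $xOy$, and let $\Phi\colon D_\zeta\to\mathbb{B}_0$ be monogenic in $D_\zeta$. Then every real component $U_k=\mathrm{U}_k[\Phi]\colon D\to\mathbb{R}$, $k=1,2,3,4$, satisfies the equation $$\frac{\partial^4 U_k}{\partial y^4}+(p^2+1)\frac{\partial^4 U_k}{\partial x^2\partial y^2}+p^2\frac{\partial^4 U_k}{\partial x^4}=0\quad\text{in } D.$$
   Context: $\mathbb{B}_0$ is the commutative associative two-dimensional algebra over $\mathbb{C}$ with unit $e$ and basis $(e,\omega)$, $\omega^2=e$. It has the orthogonal idempotents $\mathcal{I}_1=\frac12(e+\omega)$, $\mathcal{I}_2=\frac12(e-\omega)$, with $\mathcal{I}_1\mathcal{I}_2=0$, $\mathcal{I}_1+\mathcal{I}_2=e$. Fix $p>0$, $p\neq1$, and the $\mathbb{C}$-basis of $\mathbb{B}_0$ $$e_1=e,\qquad e_2=i(\mathcal{I}_1+p\,\mathcal{I}_2),$$ whose multiplication table is $e_1e_2=e_2$, $e_2^2=p\,e_1+i(p+1)e_2$. Let $\mu_{e_1,e_2}=\{xe_1+ye_2: x,y\in\mathbb{R}\}$; every nonzero element of $\mu_{e_1,e_2}$ is invertible in $\mathbb{B}_0$. For a domain $D\subset\mathbb{R}^2$ put $D_\zeta=\{\zeta=xe_1+ye_2:(x,y)\in D\}$. A function $\Phi\colon D_\zeta\to\mathbb{B}_0$ is monogenic in $D_\zeta$ if at every $\zeta\in D_\zeta$ the limit $$\Phi'(\zeta)=\lim_{h\to0,\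 h\in\mu_{e_1,e_2}}(\Phi(\zeta+h)-\Phi(\zeta))h^{-1}$$ exists. Every $\Phi\colon D_\zeta\to\mathbb{B}_0$ is written uniquely as $\Phi(\zeta)=U_1(x,y)e_1+U_2(x,y)\,ie_1+U_3(x,y)e_2+U_4(x,y)\,ie_2$ with real-valued $U_k\colon D\to\mathbb{R}$, $\zeta=xe_1+ye_2$, and $\mathrm{U}_k[\Phi]:=U_k$. *)

(* Defs.v *)
From Stdlib Require Import Reals Lra.
From Coquelicot Require Import Coquelicot.
Open Scope R_scope.

(* An element [(a, b)] stands for [a e + b omega], with [omega ^ 2 = e].  Sums,
   complex multiples and the topology are those of the product module. *)
Definition B0 : NormedModule C_AbsRing :=
  prod_NormedModule C_AbsRing C_NormedModule C_NormedModule.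

Definition Bmul (u v : B0) : B0 :=
  (Cplus (Cmult (fst u) (fst v)) (Cmult (snd u) (snd v)),
   Cplus (Cmult (fst u) (snd v)) (Cmult (snd u) (fst v))).

Definition Be : B0 := (RtoC 1, RtoC 0).
Definition Bomega : B0 := (RtoC 0, RtoC 1).

Definition invertible (u : B0) : Prop := exists v : B0, Bmul u v = Be.

(* [(a e + b omega) (a e - b omega) = (a^2 - b^2) e]; the value is meaningful
   only for invertible arguments, see [Bmul_inv_r]. *)
Definition Binv (u : B0) : B0 :=
  let d := Cminus (Cmult (fst u) (fst u)) (Cmult (snd u) (snd u)) in
  (Cdiv (fst u) d, Copp (Cdiv (snd u) d)).

Definition I1 : B0 := scal (RtoC (/ 2)) (plus Be Bomega).
Definition I2 : B0 := scal (RtoC (/ 2)) (minus Be Bomega).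

Definition e1 : B0 := Be.
Definition e2 (p : R) : B0 := scal Ci (plus I1 (scal (RtoC p) I2)).

Definition zeta (p x y : R) : B0 :=
  plus (scal (RtoC x) e1) (scal (RtoC y) (e2 p)).

Definition mu (p : R) (h : B0) : Prop := exists x y : R, h = zeta p x y.

Definition connected_set (D : R * R -> Prop) : Prop :=
  forall A B : R * R -> Prop, open A -> open B ->
  (forall z, D z -> A z \/ B z) ->
  (exists z, D z /\ A z) -> (exists z, D z /\ B z) ->
  exists z, D z /\ A z /\ B z.

Definition planar_domain (D : R * R -> Prop) : Prop :=
  (exists z, D z) /\ open D /\ connected_set D.

Definition D_zeta (p : R) (D : R * R -> Prop) (w : B0) : Prop :=
  exists x y : R, D (x, y) /\ w = zeta p x y.

(* [Phi] is a total function, but as [D] is open only its values on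
   [D_zeta p D] matter. *)
Definition monogenic (p : R) (D : R * R -> Prop) (Phi : B0 -> B0) : Prop :=
  forall w : B0, D_zeta p D w ->
  exists l : B0,
    filterlim (fun h : B0 => Bmul (minus (Phi (plus w h)) (Phi w)) (Binv h))
      (within (fun h : B0 => mu p h /\ h <> zero) (locally (zero : B0)))
      (locally l).

(* [U k], for k = 1, 2, 3, 4, is the k-th real component of [Phi]; by
   [real_components_exist] and [real_components_unique] the functions
   [U 1], ..., [U 4] exist and are determined on [D] by [Phi]. *)
Definition real_components (p : R) (D : R * R -> Prop) (Phi : B0 -> B0)
    (U : nat -> R -> R -> R) : Prop :=
  forall x y : R, D (x, y) ->
  Phi (zeta p x y) =
    plus (plus (scal (RtoC (U 1%nat x y)) e1)
               (scal (RtoC (U 2%nat x y)) (scal Ci e1)))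
         (plus (scal (RtoC (U 3%nat x y)) (e2 p))
               (scal (RtoC (U 4%nat x y)) (scal Ci (e2 p)))).

Ltac B0_unfold :=
  repeat match goal with u : NormedModule.sort _ B0 |- _ =>
    destruct u as [[? ?] [? ?]] end;
  cbv [Bmul Be Bomega I1 I2 e1 e2 zeta Binv];
  cbn -[Rplus Rmult Rminus Ropp Rinv];
  repeat (progress (
    cbv [Cplus Cmult Copp Cminus Cdiv Ci RtoC plus opp scal mult minus zero
         prod_plus prod_opp prod_scal prod_zero];
    cbn -[Rplus Rmult Rminus Ropp Rinv])).

Ltac B0_ring := intros; B0_unfold;
  repeat match goal with |- (_, _) = (_, _) => apply f_equal2 end;
  try ring; try field; try lra.

Lemma Bmul_comm (u v : B0) : Bmul u v = Bmul v u.
Proof. B0_ring. Qed.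

Lemma Bmul_assoc (u v w : B0) : Bmul u (Bmul v w) = Bmul (Bmul u v) w.
Proof. B0_ring. Qed.

Lemma Bmul_e (u : B0) : Bmul Be u = u.
Proof. B0_ring. Qed.

Lemma Bmul_plus_r (u v w : B0) : Bmul u (plus v w) = plus (Bmul u v) (Bmul u w).
Proof. B0_ring. Qed.

Lemma Bmul_scal_r (a : C) (u v : B0) : Bmul u (scal a v) = scal a (Bmul u v).
Proof. destruct a; B0_ring. Qed.

Lemma Bomega_sqr : Bmul Bomega Bomega = Be.
Proof. B0_ring. Qed.

Lemma e2_sqr (p : R) :
  Bmul (e2 p) (e2 p) =
  plus (scal (RtoC p) e1) (scal (Cmult Ci (RtoC (p + 1))) (e2 p)).
Proof. B0_ring. Qed.

Lemma Bmul_inv_r (u : B0) : invertible u -> Bmul u (Binv u) = Be.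
Proof.
destruct u as [a b]; intros [[c d] H].
unfold Bmul, Be in H; cbn in H; injection H as H1 H2 H3 H4.
assert (H5 : Cplus (Cmult a c) (Cmult b d) = RtoC 1).
{ apply injective_projections; assumption. }
assert (H6 : Cplus (Cmult a d) (Cmult b c) = RtoC 0).
{ apply injective_projections; assumption. }
assert (Hd : Cminus (Cmult a a) (Cmult b b) <> RtoC 0).
{ intros E.
  assert (K : Cmult (Cminus (Cmult a a) (Cmult b b))
                (Cminus (Cmult c c) (Cmult d d)) =
              Cminus (Cmult (Cplus (Cmult a c) (Cmult b d))
                            (Cplus (Cmult a c) (Cmult b d)))
                     (Cmult (Cplus (Cmult a d) (Cmult b c))
                            (Cplus (Cmult a d) (Cmult b c)))) by ring.
  rewrite E, H5, H6 in K.
  apply (f_equal fst) in K; cbn in K; lra. }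
unfold Bmul, Binv, Be; cbn [fst snd].
apply f_equal2; field; exact Hd.
Qed.

Lemma mu_invertible (p : R) (h : B0) :
  0 < p -> mu p h -> h <> zero -> invertible h.
Proof.
intros Hp [x [y E]] Hh.
assert (Hxy : x <> 0 \/ y <> 0).
{ destruct (Req_dec x 0) as [Hx|Hx]; [right|now left].
  intros Hy; apply Hh; rewrite E, Hx, Hy; B0_ring. }
assert (N : forall q, 0 < q -> x * x + q * y * (q * y) <> 0).
{ intros q Hq K.
  assert (K1 : x = 0) by nra.
  assert (K2 : q * y = 0) by nra.
  apply Rmult_integral in K2; lra. }
assert (N1 := N 1 Rlt_0_1); assert (Np := N p Hp).
pose (c := fun q : R => (x / (x * x + q * y * (q * y)),
                         - (q * y) / (x * x + q * y * (q * y))) : C).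
exists (plus (scal (c 1) I1) (scal (c p) I2)).
unfold c.
rewrite E; B0_ring; split; assumption.
Qed.

Lemma real_components_exist (p : R) (D : R * R -> Prop) (Phi : B0 -> B0) :
  0 < p -> p <> 1 -> exists U, real_components p D Phi U.
Proof.
intros Hp Hp1.
pose (beta := fun (w : B0) => (2 * snd (snd w) / (1 - p),
                               - 2 * fst (snd w) / (1 - p)) : C).
pose (alpha := fun (w : B0) =>
  (fst (fst w) + fst (snd w) + snd (beta w),
   snd (fst w) + snd (snd w) - fst (beta w)) : C).
exists (fun k x y =>
  let w := Phi (zeta p x y) in
  match k with
  | 1%nat => fst (alpha w)
  | 2%nat => snd (alpha w)
  | 3%nat => fst (beta w)
  | _ => snd (beta w)
  end).
intros x y _; cbv zeta; generalize (Phi (zeta p x y)); intros w.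
unfold alpha, beta.
B0_ring.
Qed.

Lemma real_components_unique (p : R) (D : R * R -> Prop) (Phi : B0 -> B0)
    (U V : nat -> R -> R -> R) :
  p <> 1 -> real_components p D Phi U -> real_components p D Phi V ->
  forall (k : nat) (x y : R), (1 <= k <= 4)%nat -> D (x, y) ->
  U k x y = V k x y.
Proof.
intros Hp1 HU HV k x y Hk Dxy.
assert (H := HU x y Dxy); rewrite (HV x y Dxy) in H; clear HU HV.
revert H; B0_unfold; intros H.
injection H as H1 H2 H3 H4.
assert (K3 : (1 - p) * (U 3%nat x y - V 3%nat x y) = 0) by lra.
assert (K4 : (1 - p) * (U 4%nat x y - V 4%nat x y) = 0) by lra.
apply Rmult_integral in K3; apply Rmult_integral in K4.
assert (L3 : U 3%nat x y = V 3%nat x y) by lra.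
assert (L4 : U 4%nat x y = V 4%nat x y) by lra.
rewrite L3, L4 in *.
destruct k as [|[|[|[|[|k]]]]]; try assumption; try lra; exfalso.
- inversion Hk; now apply (Nat.nle_succ_0 0).
- destruct Hk as [_ Hk]; do 4 apply le_S_n in Hk; now apply (Nat.nle_succ_0 k).
Qed.

(* Main.v *)
Require Import Defs.
From Stdlib Require Import Reals Lra Lia ClassicalEpsilon.
From Coquelicot Require Import Coquelicot.
Open Scope R_scope.

(** In the idempotent basis, [Phi = F1 I1 + F2 I2]; monogenicity says that [F1] is
    complex differentiable as a function of [x + i y] and [F2] as a function of
    [x + i p y].  Complex differentiable functions are smooth, so each [U k] is
    a sum [Re (a F1 (x + i y)) + Re (b F2 (x + i p y))] whose summands are killed
    by the commuting factors [dy^2 + dx^2] and [dy^2 + p^2 dx^2] of the operator.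

    Since only pointwise differentiability is given, smoothness goes through
    Goursat's lemma, which yields local primitives.  For [F] with continuous
    derivative, let [P s] be the integral over [0, 2 pi] of
    [F (z + s e^(i t)) e^(- i t)].  Integration by parts gives [P s = s P' s], so
    [P] is linear in [s] and [2 pi r F' z] is the integral of
    [F (z + r e^(i t)) e^(- i t)].  The right-hand side may be differentiated
    in [z] under the integral sign: applied to the primitive and then to the
    function itself, this makes the derivative complex differentiable. *)

Local Notation VC := C_R_CompleteNormedModule.

Ltac Cring := match goal with |- ?a = ?b => change (@eq C a b); ring end.

(** * Complex differentiability *)

(** Stated without a quotient and with a non-strict bound, so that [w = z] needs no exclusion and
    the estimate can be multiplied, summed and integrated directly. *)
Definition cderiv (f : C -> C) (z l : C) : Prop :=
  forall eps : R, 0 < eps -> exists delta : R, 0 < delta /\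
  forall w : C, Cmod (w - z) < delta ->
  Cmod (f w - f z - l * (w - z)) <= eps * Cmod (w - z).

Definition ccont (f : C -> C) (z : C) : Prop :=
  forall eps : R, 0 < eps -> exists delta : R, 0 < delta /\
  forall w : C, Cmod (w - z) < delta -> Cmod (f w - f z) <= eps.

(** * Modulus, discs and the topology of the complex plane *)

Lemma norm_Cmod (x : C) : @norm R_AbsRing C_R_NormedModule x = Cmod x.
Proof.
destruct x as [x y]; unfold norm; simpl; unfold prod_norm, Cmod, norm; simpl.
unfold abs; simpl.
apply f_equal; now rewrite !Rmult_1_r, <- !Rabs_mult, !Rabs_pos_eq by apply Rle_0_sqr.
Qed.

Lemma Cmod_minus_sym (a b : C) : Cmod (a - b) = Cmod (b - a).
Proof. rewrite <- Cmod_opp; apply f_equal; ring. Qed.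

Lemma Cmod_dist_triangle (a b c : C) :
  Cmod (a - c) <= Cmod (a - b) + Cmod (b - c).
Proof.
replace (a - c)%C with ((a - b) + (b - c))%C by ring; apply Cmod_triangle.
Qed.

Lemma Cmod_scal_R (t : R) (z : C) : Cmod (t * z) = Rabs t * Cmod z.
Proof. now rewrite Cmod_mult, Cmod_R. Qed.

(** If [z] were nonzero, [eps = 1] would force [K > 0], and [eps = Cmod z / (2 * K)] would then give
    [Cmod z <= Cmod z / 2]. *)
Lemma Cmod_small_eq_0 (z : C) (K : R) :
  (forall eps, 0 < eps -> Cmod z <= K * eps) -> z = 0.
Proof.
intros H; apply Cmod_eq_0.
destruct (Rle_lt_or_eq_dec 0 (Cmod z) (Cmod_ge_0 z)) as [Hz|Hz]; [|easy].
exfalso.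
assert (HK : 0 < K) by (specialize (H 1 Rlt_0_1); lra).
assert (Hq : 0 < Cmod z / (2 * K)) by (apply Rdiv_lt_0_compat; lra).
specialize (H _ Hq); replace (K * (Cmod z / (2 * K))) with (Cmod z / 2) in H
  by (field; lra).
lra.
Qed.

(** Balls of the product uniform structure are squares; a square of half-side [d / sqrt 2] fits into
    the disc of radius [d]. *)
Lemma locally_Cmod (z : C) (P : C -> Prop) :
  locally (T := C_UniformSpace) z P <->
  exists d, 0 < d /\ forall w, Cmod (w - z) < d -> P w.
Proof.
split.
- intros [d Hd]; exists d; split; [apply cond_pos|].
  intros w Hw; apply Hd; now apply C_NormedModule_mixin_compat1.
- intros [d [Hd H]].
  assert (H2 : 0 < d / sqrt 2).
  { apply Rdiv_lt_0_compat; [easy|apply Rlt_sqrt2_0]. }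
  exists (mkposreal _ H2); intros w Hw; apply H.
  apply C_NormedModule_mixin_compat2 in Hw; simpl in Hw.
  replace (sqrt 2 * (d / sqrt 2)) with d in Hw; [exact Hw|].
  field; apply Rgt_not_eq, Rlt_sqrt2_0.
Qed.

Lemma continuous_Cmod {T : UniformSpace} (f : T -> C) (x : T) :
  continuous (U := C_UniformSpace) f x <->
  forall eps, 0 < eps -> locally x (fun y => Cmod (f y - f x) <= eps).
Proof.
split.
- intros H eps He; apply (H (fun z => Cmod (z - f x) <= eps)), locally_Cmod.
  exists eps; split; [easy|]; intros; lra.
- intros H P HP; apply locally_Cmod in HP; destruct HP as [d [Hd HP]].
  assert (H2 : 0 < d / 2) by lra.
  unfold filtermap; generalize (H _ H2); apply filter_imp.
  intros y Hy; apply HP; lra.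
Qed.

Lemma ccont_continuous (f : C -> C) (z : C) :
  ccont f z <-> continuous (T := C_UniformSpace) (U := C_UniformSpace) f z.
Proof.
rewrite continuous_Cmod; split; intros H eps He.
- apply locally_Cmod; now apply H.
- now apply locally_Cmod, H.
Qed.

Lemma cderiv_ccont (f : C -> C) (z l : C) : cderiv f z l -> ccont f z.
Proof.
intros H eps He.
destruct (H 1 Rlt_0_1) as [d [Hd H1]].
assert (Hl := Cmod_ge_0 l).
assert (Hq : 0 < eps / (1 + Cmod l)) by (apply Rdiv_lt_0_compat; lra).
exists (Rmin d (eps / (1 + Cmod l))); split; [now apply Rmin_glb_lt|].
intros w Hw.
assert (Hw1 := Rlt_le_trans _ _ _ Hw (Rmin_l _ _)).
assert (Hw2 := Rlt_le_trans _ _ _ Hw (Rmin_r _ _)).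
replace (f w - f z)%C with ((f w - f z - l * (w - z)) + l * (w - z))%C by ring.
eapply Rle_trans; [apply Cmod_triangle|].
rewrite Cmod_mult; specialize (H1 w Hw1).
apply Rmult_lt_compat_r with (r := 1 + Cmod l) in Hw2; [|lra].
replace (eps / (1 + Cmod l) * (1 + Cmod l)) with eps in Hw2 by (field; lra).
lra.
Qed.

Lemma cderiv_unique (f : C -> C) (z l m : C) :
  cderiv f z l -> cderiv f z m -> l = m.
Proof.
intros Hl Hm.
enough (E : (l - m)%C = 0).
{ replace l with ((l - m) + m)%C by ring; rewrite E; ring. }
apply (Cmod_small_eq_0 _ 2); intros eps He.
destruct (Hl eps He) as [d1 [Hd1 H1]]; destruct (Hm eps He) as [d2 [Hd2 H2]].
(* Both remainder estimates are compared at the single point [z + d], with [d] real and strictly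
   below both radii. *)
pose (d := Rmin d1 d2 / 2).
assert (Hd : 0 < d) by (unfold d; generalize (Rmin_glb_lt _ _ _ Hd1 Hd2); lra).
assert (Hd1' : d < d1) by (unfold d in *; generalize (Rmin_l d1 d2); lra).
assert (Hd2' : d < d2) by (unfold d in *; generalize (Rmin_r d1 d2); lra).
assert (Ed : Cmod ((z + d) - z) = d).
{ replace (z + d - z)%C with (RtoC d) by ring; rewrite Cmod_R; apply Rabs_pos_eq; lra. }
specialize (H1 (z + d)%C); specialize (H2 (z + d)%C); rewrite Ed in H1, H2.
specialize (H1 Hd1'); specialize (H2 Hd2').
assert (H3 : Cmod ((l - m) * d) <= 2 * eps * d).
{ replace ((l - m) * d)%C with ((f (z + d) - f z - m * (z + d - z))
    - (f (z + d) - f z - l * (z + d - z)))%C by ring.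
  unfold Cminus at 1; eapply Rle_trans; [apply Cmod_triangle|].
  rewrite Cmod_opp; lra. }
rewrite Cmod_mult, Cmod_R, Rabs_pos_eq in H3 by lra.
now apply Rmult_le_reg_r with d.
Qed.

Lemma cderiv_ext_loc (f g : C -> C) (z l : C) (d : R) :
  0 < d -> (forall w, Cmod (w - z) < d -> f w = g w) ->
  cderiv f z l -> cderiv g z l.
Proof.
intros Hd E H eps He; destruct (H eps He) as [d1 [Hd1 H1]].
exists (Rmin d d1); split; [now apply Rmin_glb_lt|].
intros w Hw.
rewrite <- !E.
- apply H1; eapply Rlt_le_trans; [exact Hw|apply Rmin_r].
- replace (z - z)%C with (RtoC 0) by ring; now rewrite Cmod_0.
- eapply Rlt_le_trans; [exact Hw|apply Rmin_l].
Qed.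

Lemma cderiv_scal (c : C) (f : C -> C) (z l : C) :
  cderiv f z l -> cderiv (fun w => c * f w)%C z (c * l).
Proof.
intros H eps He.
assert (Hc := Cmod_ge_0 c).
assert (Hq : 0 < eps / (1 + Cmod c)) by (apply Rdiv_lt_0_compat; lra).
destruct (H _ Hq) as [d [Hd H1]]; exists d; split; [easy|].
intros w Hw.
replace (c * f w - c * f z - c * l * (w - z))%C
  with (c * (f w - f z - l * (w - z)))%C by ring.
rewrite Cmod_mult.
apply Rle_trans with ((1 + Cmod c) * (eps / (1 + Cmod c) * Cmod (w - z))).
- apply Rmult_le_compat; try apply Cmod_ge_0; [lra|now apply H1].
- right; field; lra.
Qed.

(** * Calculus along paths in the complex plane *)

Lemma is_linear_Cmult (l : C) :
  is_linear (U := C_R_NormedModule) (V := C_R_NormedModule) (fun h : C => (l * h)%C).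
Proof.
split.
- intros x y; exact (Cmult_plus_distr_l l x y).
- intros k x; rewrite !scal_R_Cmult; Cring.
- exists (1 + Cmod l); split; [generalize (Cmod_ge_0 l); lra|].
  intros x; rewrite !norm_Cmod, Cmod_mult.
  apply Rmult_le_compat_r; [apply Cmod_ge_0|lra].
Qed.

(** A complex derivative is a real differential given by multiplication by [l]; this makes the chain
    rule for real differentials available along paths. *)
Lemma cderiv_filterdiff (f : C -> C) (z l : C) :
  cderiv f z l ->
  filterdiff (U := C_R_NormedModule) (V := C_R_NormedModule) f
    (locally (T := C_R_NormedModule) z) (fun h : C => (l * h)%C).
Proof.
intros H; split; [apply is_linear_Cmult|].
intros x Hx; apply (is_filter_lim_locally_unique (V := C_R_NormedModule)) in Hx; subst x.
intros [eps He]; apply locally_Cmod.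
destruct (H eps He) as [d [Hd H1]]; exists d; split; [easy|].
intros w Hw; simpl; rewrite !norm_Cmod; now apply H1.
Qed.

Lemma is_derive_cderiv_comp (f : C -> C) (g : R -> C) (t : R) (l dg : C) :
  cderiv f (g t) l -> is_derive (V := C_R_NormedModule) g t dg ->
  is_derive (V := C_R_NormedModule) (fun s => f (g s)) t (l * dg)%C.
Proof.
intros Hf Hg.
apply cderiv_filterdiff in Hf.
unfold is_derive; eapply filterdiff_ext_lin.
- apply (filterdiff_comp' g f t _ _ Hg Hf).
- intros y; simpl; rewrite !scal_R_Cmult; Cring.
Qed.

Lemma is_derive_pair (u v : R -> R) (t du dv : R) :
  is_derive u t du -> is_derive v t dv ->
  is_derive (V := C_R_NormedModule) (fun s => (u s, v s) : C) t ((du, dv) : C).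
Proof.
intros Hu Hv.
assert (H : is_derive (V := C_R_NormedModule)
  (fun s => (RtoC (u s) + Ci * RtoC (v s))%C) t (RtoC du + Ci * RtoC dv)%C).
(* The pair is split as [u * 1 + v * Ci], real functions times constant vectors. *)
{ assert (K : forall (w : R -> R) dw (a : C), is_derive w t dw ->
    is_derive (V := C_R_NormedModule) (fun s => (a * RtoC (w s))%C) t (a * RtoC dw)%C).
  { intros w dw a Hw.
    apply is_derive_ext with (fun s => scal (V := C_R_NormedModule) (w s) a).
    - intros s; rewrite scal_R_Cmult; Cring.
    - replace (a * RtoC dw)%C with (scal (V := C_R_NormedModule) dw a)
        by (rewrite scal_R_Cmult; Cring).
      now apply (is_derive_scal_l (V := C_R_NormedModule)). }
  apply (is_derive_plus (V := C_R_NormedModule)).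
  - apply is_derive_ext with (fun s => (1 * RtoC (u s))%C); [intros; Cring|].
    replace (RtoC du) with (1 * RtoC du)%C by ring; now apply K.
  - now apply K. }
replace ((du, dv) : C) with (RtoC du + Ci * RtoC dv)%C
  by (apply injective_projections; simpl; ring).
eapply is_derive_ext; [|exact H].
intros s; apply injective_projections; simpl; ring.
Qed.

Lemma is_derive_fst (g : R -> C) (t : R) (l : C) :
  is_derive (V := C_R_NormedModule) g t l -> is_derive (fun s => fst (g s)) t (fst l).
Proof.
intros H; unfold is_derive.
apply (filterdiff_comp' g (fun z : C => fst z) t _ (fun z : C => fst z) H).
apply (filterdiff_linear (U := C_R_NormedModule) (V := R_NormedModule)), is_linear_fst.
Qed.

Lemma is_derive_snd (g : R -> C) (t : R) (l : C) :
  is_derive (V := C_R_NormedModule) g t l -> is_derive (fun s => snd (g s)) t (snd l).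
Proof.
intros H; unfold is_derive.
apply (filterdiff_comp' g (fun z : C => snd z) t _ (fun z : C => snd z) H).
apply (filterdiff_linear (U := C_R_NormedModule) (V := R_NormedModule)), is_linear_snd.
Qed.

Lemma is_derive_Cmult (f g : R -> C) (t : R) (df dg : C) :
  is_derive (V := C_R_NormedModule) f t df -> is_derive (V := C_R_NormedModule) g t dg ->
  is_derive (V := C_R_NormedModule) (fun s => f s * g s)%C t (df * g t + f t * dg)%C.
Proof.
intros Hf Hg.
assert (F1 := is_derive_fst _ _ _ Hf); assert (F2 := is_derive_snd _ _ _ Hf).
assert (G1 := is_derive_fst _ _ _ Hg); assert (G2 := is_derive_snd _ _ _ Hg).
assert (E : (df * g t + f t * dg)%C =
  ((fst df * fst (g t) + fst (f t) * fst dg) - (snd df * snd (g t) + snd (f t) * snd dg),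
   (fst df * snd (g t) + fst (f t) * snd dg) + (snd df * fst (g t) + snd (f t) * fst dg)))
  by (apply injective_projections; simpl; ring).
assert (M : forall u v du dv, is_derive u t du -> is_derive v t dv ->
  is_derive (fun s => u s * v s) t (du * v t + u t * dv)).
{ intros u v du dv Hu Hv; exact (is_derive_mult u v t du dv Hu Hv Rmult_comm). }
rewrite E; apply is_derive_pair.
- apply (is_derive_minus (V := R_NormedModule) (fun s => fst (f s) * fst (g s))
    (fun s => snd (f s) * snd (g s))); now apply M.
- apply (is_derive_plus (V := R_NormedModule) (fun s => fst (f s) * snd (g s))
    (fun s => snd (f s) * fst (g s))); now apply M.
Qed.

Lemma is_derive_affine (a b : C) (t : R) :
  is_derive (V := C_R_NormedModule) (fun s : R => (a + s * b)%C) t b.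
Proof.
apply is_derive_ext with (fun s => (fst a + s * fst b, snd a + s * snd b) : C).
- intros s; apply injective_projections; simpl; ring.
- destruct b as [b1 b2]; apply is_derive_pair; auto_derive; trivial; simpl; ring.
Qed.

Lemma continuous_pair {T : UniformSpace} (u v : T -> R) (t : T) :
  continuous u t -> continuous v t ->
  continuous (U := C_UniformSpace) (fun s => (u s, v s) : C) t.
Proof.
intros Hu Hv.
apply (continuous_comp_2 (X := C_UniformSpace) u v (fun a b => (a, b) : C) t Hu Hv).
intros P HP; unfold filtermap; revert HP; apply filter_imp; now intros [a b].
Qed.

Lemma continuous_Cmult {T : UniformSpace} (f g : T -> C) (t : T) :
  continuous (U := C_UniformSpace) f t -> continuous (U := C_UniformSpace) g t ->
  continuous (U := C_UniformSpace) (fun s => f s * g s)%C t.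
Proof.
intros Hf Hg.
assert (K1 : forall h : T -> C, continuous (U := C_UniformSpace) h t ->
  continuous (fun s => fst (h s)) t).
{ intros h Hh; apply (continuous_comp h (fun z : C => fst z) t Hh).
  destruct (h t); apply continuous_fst. }
assert (K2 : forall h : T -> C, continuous (U := C_UniformSpace) h t ->
  continuous (fun s => snd (h s)) t).
{ intros h Hh; apply (continuous_comp h (fun z : C => snd z) t Hh).
  destruct (h t); apply continuous_snd. }
apply continuous_pair.
- apply (continuous_minus (V := R_NormedModule)); apply (continuous_mult (K := R_AbsRing)); auto.
- apply (continuous_plus (V := R_NormedModule)); apply (continuous_mult (K := R_AbsRing)); auto.
Qed.

Lemma continuous_Cplus {T : UniformSpace} (f g : T -> C) (t : T) :
  continuous (U := C_UniformSpace) f t -> continuous (U := C_UniformSpace) g t ->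
  continuous (U := C_UniformSpace) (fun s => f s + g s)%C t.
Proof. exact (continuous_plus (V := C_R_NormedModule) f g t). Qed.

Lemma continuous_affine (a b : C) (t : R) :
  continuous (U := C_UniformSpace) (fun s : R => (a + s * b)%C) t.
Proof.
apply (ex_derive_continuous (V := C_R_NormedModule)).
eexists; apply is_derive_affine.
Qed.

(** * Goursat's lemma *)

Definition seg (a b : C) (t : R) : C := (a + t * (b - a))%C.

Definition segint (f : C -> C) (a b : C) : C :=
  RInt (V := VC) (fun t => f (seg a b t) * (b - a))%C 0 1.

Lemma seg_disc (c a b : C) (r t : R) :
  Cmod (a - c) <= r -> Cmod (b - c) <= r -> 0 <= t <= 1 ->
  Cmod (seg a b t - c) <= r.
Proof.
intros Ha Hb Ht; unfold seg.
replace (a + t * (b - a) - c)%C with ((1 - t)%R * (a - c) + t * (b - c))%C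
  by (rewrite RtoC_minus; ring).
eapply Rle_trans; [apply Cmod_triangle|].
rewrite !Cmod_scal_R, !Rabs_pos_eq by lra.
apply Rle_trans with ((1 - t) * r + t * r); [|lra].
apply Rplus_le_compat; apply Rmult_le_compat_l; lra.
Qed.

Lemma is_RInt_segint (f : C -> C) (a b : C) :
  (forall t, 0 <= t <= 1 -> ccont f (seg a b t)) ->
  is_RInt (V := C_R_NormedModule) (fun t => f (seg a b t) * (b - a))%C 0 1 (segint f a b).
Proof.
intros H; apply (RInt_correct (V := VC)), (ex_RInt_continuous (V := VC)).
rewrite Rmin_left, Rmax_right by lra; intros t Ht.
apply continuous_Cmult; [|apply (continuous_const (V := C_UniformSpace))].
apply (continuous_comp (seg a b) f t (continuous_affine _ _ _)).
now apply ccont_continuous, H.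
Qed.

(** By the fundamental theorem of calculus [A b - A a] is the integral of [A'] along the segment, so
    the difference is the integral of [f - A'], bounded by [M] times the length. In Goursat's lemma
    [A'] is affine; in the construction of primitives it is constant. *)
Lemma segint_approx (f A A' : C -> C) (a b : C) (M : R) :
  (forall t, 0 <= t <= 1 -> ccont f (seg a b t)) ->
  (forall t, 0 <= t <= 1 -> ccont A' (seg a b t)) ->
  (forall t, 0 <= t <= 1 -> cderiv A (seg a b t) (A' (seg a b t))) ->
  (forall t, 0 <= t <= 1 -> Cmod (f (seg a b t) - A' (seg a b t)) <= M) ->
  Cmod (segint f a b - (A b - A a)) <= M * Cmod (b - a).
Proof.
intros Hf HA' HA HM.
assert (H1 : is_RInt (V := C_R_NormedModule)
  (fun t => A' (seg a b t) * (b - a))%C 0 1 (A b - A a)%C).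
{ assert (E1 : seg a b 1 = b) by (unfold seg; ring).
  assert (E0 : seg a b 0 = a) by (unfold seg; ring).
  replace (A b - A a)%C with (A (seg a b 1) - A (seg a b 0))%C by (now rewrite E1, E0).
  apply (is_RInt_derive (V := VC) (fun t => A (seg a b t)));
    rewrite Rmin_left, Rmax_right by lra; intros t Ht.
  - apply is_derive_cderiv_comp; [now apply HA|apply is_derive_affine].
  - apply continuous_Cmult; [|apply (continuous_const (V := C_UniformSpace))].
    apply (continuous_comp (seg a b) A' t (continuous_affine _ _ _)).
    now apply ccont_continuous, HA'. }
assert (H2 := is_RInt_minus _ _ _ _ _ _ (is_RInt_segint f a b Hf) H1).
rewrite <- norm_Cmod.
replace (M * Cmod (b - a)) with ((1 - 0) * (M * Cmod (b - a))) by ring.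
refine (norm_RInt_le_const _ _ _ _ _ Rle_0_1 _ H2).
intros t Ht; rewrite norm_Cmod.
match goal with |- Cmod ?u <= _ =>
  replace u with ((f (seg a b t) - A' (seg a b t)) * (b - a))%C end.
2: { match goal with |- _ = ?v => change v with
  (f (seg a b t) * (b - a) - A' (seg a b t) * (b - a))%C end; ring. }
rewrite Cmod_mult; apply Rmult_le_compat_r; [apply Cmod_ge_0|now apply HM].
Qed.

Lemma segint_swap (f : C -> C) (a b : C) :
  (forall t, 0 <= t <= 1 -> ccont f (seg a b t)) ->
  segint f b a = (- segint f a b)%C.
Proof.
intros H; apply (is_RInt_unique (V := VC)).
assert (H1 := is_RInt_swap _ _ _ _ (is_RInt_segint f a b H)).
(* The bounds are put in the form required by the substitution of [1 - t] for [t]. *)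
replace 1 with (-1 * 0 + 1) in H1 at 1 by ring.
replace 0 with (-1 * 1 + 1) in H1 at 2 by ring.
apply is_RInt_comp_lin in H1.
eapply is_RInt_ext; [|exact H1].
intros t _; cbv beta; rewrite scal_R_Cmult.
replace (seg a b (-1 * t + 1)) with (seg b a t)
  by (unfold seg; rewrite RtoC_plus, RtoC_mult; ring).
Cring.
Qed.

Definition midpoint (a b : C) : C := ((a + b) * (/ 2)%R)%C.

Lemma half_C : RtoC (/ 2) = (/ 2)%C.
Proof. apply RtoC_inv; lra. Qed.

(** The two halves of [[0, 1]] are rescaled by [t / 2] and [t / 2 + 1 / 2]; the Jacobian [1 / 2]
    turns [b - a] into the displacement along a half segment. *)
Lemma segint_midpoint (f : C -> C) (a b : C) :
  (forall t, 0 <= t <= 1 -> ccont f (seg a b t)) ->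
  segint f a b = (segint f a (midpoint a b) + segint f (midpoint a b) b)%C.
Proof.
intros H; assert (H1 := is_RInt_segint f a b H).
assert (H2 : ex_RInt (V := C_R_NormedModule) (fun t => f (seg a b t) * (b - a))%C 0 (/ 2)).
{ apply (ex_RInt_Chasles_1 (V := VC)) with 1; [lra|eexists; exact H1]. }
assert (H3 : ex_RInt (V := C_R_NormedModule) (fun t => f (seg a b t) * (b - a))%C (/ 2) 1).
{ apply (ex_RInt_Chasles_2 (V := VC)) with 0; [lra|eexists; exact H1]. }
unfold segint at 1; rewrite <- (RInt_Chasles (V := VC) _ 0 (/ 2) 1 H2 H3).
apply (RInt_correct (V := VC)) in H2; apply (RInt_correct (V := VC)) in H3.
unfold plus; simpl; unfold prod_plus; unfold plus; simpl.
match goal with |- ?l = _ => change (l = (segint f a (midpoint a b) + segint f (midpoint a b) b)%C) end.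
symmetry.
enough (E : segint f a (midpoint a b) = RInt (V := VC) (fun t => f (seg a b t) * (b - a))%C 0 (/ 2) /\
  segint f (midpoint a b) b = RInt (V := VC) (fun t => f (seg a b t) * (b - a))%C (/ 2) 1)
  by (destruct E as [-> ->]; reflexivity).
split; apply (is_RInt_unique (V := VC)).
- replace (/ 2) with (/ 2 * 1 + 0) in H2 at 1 by ring.
  replace 0 with (/ 2 * 0 + 0) in H2 at 1 by ring.
  apply is_RInt_comp_lin in H2.
  eapply is_RInt_ext; [|exact H2].
  intros t _; cbv beta; rewrite scal_R_Cmult.
  replace (seg a (midpoint a b) t) with (seg a b (/ 2 * t + 0))
    by (unfold seg, midpoint; rewrite RtoC_plus, RtoC_mult, half_C; field).
  unfold midpoint; rewrite half_C.
  match goal with |- ?a = ?b => change (@eq C a b) end; field.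
- replace 1 with (/ 2 * 1 + / 2) in H3 at 1 by field.
  replace (/ 2) with (/ 2 * 0 + / 2) in H3 at 1 by ring.
  apply is_RInt_comp_lin in H3.
  eapply is_RInt_ext; [|exact H3].
  intros t _; cbv beta; rewrite scal_R_Cmult.
  replace (seg (midpoint a b) b t) with (seg a b (/ 2 * t + / 2))
    by (unfold seg, midpoint; rewrite RtoC_plus, RtoC_mult, half_C; field).
  unfold midpoint; rewrite half_C.
  match goal with |- ?a = ?b => change (@eq C a b) end; field.
Qed.

Definition triint (f : C -> C) (a b d : C) : C :=
  (segint f a b + segint f b d + segint f d a)%C.

Lemma midpoint_disc (c a b : C) (r : R) :
  Cmod (a - c) <= r -> Cmod (b - c) <= r -> Cmod (midpoint a b - c) <= r.
Proof.
intros Ha Hb; replace (midpoint a b) with (seg a b (/ 2)).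
- apply seg_disc; auto; lra.
- unfold seg, midpoint; rewrite half_C; field.
Qed.

(** Each side of the medial triangle is traversed once in each direction and cancels; what remains
    are the six half sides. Convexity of the disc keeps every segment inside it. *)
Lemma triint_subdivision (f : C -> C) (c a b d : C) (r : R) :
  (forall z, Cmod (z - c) <= r -> ccont f z) ->
  Cmod (a - c) <= r -> Cmod (b - c) <= r -> Cmod (d - c) <= r ->
  let m1 := midpoint a b in let m2 := midpoint b d in let m3 := midpoint d a in
  triint f a b d =
    (triint f a m1 m3 + triint f m1 b m2 + triint f m3 m2 d + triint f m1 m2 m3)%C.
Proof.
intros Hf Ha Hb Hd m1 m2 m3.
assert (K : forall u v, Cmod (u - c) <= r -> Cmod (v - c) <= r ->
  forall t, 0 <= t <= 1 -> ccont f (seg u v t)).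
{ intros u v Hu Hv t Ht; apply Hf; now apply seg_disc. }
assert (H1 : Cmod (m1 - c) <= r) by now apply midpoint_disc.
assert (H2 : Cmod (m2 - c) <= r) by now apply midpoint_disc.
assert (H3 : Cmod (m3 - c) <= r) by now apply midpoint_disc.
unfold triint.
rewrite (segint_midpoint f a b), (segint_midpoint f b d), (segint_midpoint f d a) by auto.
fold m1 m2 m3.
rewrite (segint_swap f m1 m3), (segint_swap f m1 m2), (segint_swap f m2 m3) by auto.
ring.
Qed.

Lemma Cmod_quarter (x y z w : C) (s : R) : s = Cmod (x + y + z + w) ->
  s <= 4 * Cmod x \/ s <= 4 * Cmod y \/ s <= 4 * Cmod z \/ s <= 4 * Cmod w.
Proof.
intros ->.
assert (H : Cmod (x + y + z + w) <= Cmod x + Cmod y + Cmod z + Cmod w).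
{ eapply Rle_trans; [apply Cmod_triangle|].
  apply Rplus_le_compat_r.
  eapply Rle_trans; [apply Cmod_triangle|].
  apply Rplus_le_compat_r, Cmod_triangle. }
lra.
Qed.

(** * Repeated bisection of a triangle *)

Definition triangle : Type := (C * C * C)%type.
Definition perimeter (T : triangle) : R :=
  let '(a, b, d) := T in Cmod (b - a) + Cmod (d - b) + Cmod (a - d).
Definition in_disc (c : C) (r : R) (T : triangle) : Prop :=
  let '(a, b, d) := T in Cmod (a - c) <= r /\ Cmod (b - c) <= r /\ Cmod (d - c) <= r.
(** A marked vertex recording the position of a triangle: the limit of the apexes takes the place of
    the common point of nested triangles. *)
Definition apex (T : triangle) : C := let '(a, _, _) := T in a.
Definition boundary_int (f : C -> C) (T : triangle) : C :=
  let '(a, b, d) := T in triint f a b d.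

Lemma half_dist (u v x y : C) : (u - v = (x - y) * / 2)%C -> Cmod (u - v) = Cmod (x - y) / 2.
Proof.
intros ->; rewrite <- half_C, Cmod_mult, Cmod_R, Rabs_pos_eq by lra; lra.
Qed.

(** All sides of the four subtriangles are half the original ones, and one of the four integrals has
    at least a quarter of the total modulus. The new apex is the old one, a midpoint of a side
    through it, or the vertex [b] or a midpoint, hence never farther than the perimeter. *)
Lemma bisect (f : C -> C) (c : C) (r : R) (T : triangle) :
  (forall z, Cmod (z - c) <= r -> ccont f z) -> in_disc c r T ->
  exists T', in_disc c r T' /\ perimeter T' = perimeter T / 2 /\
    Cmod (apex T' - apex T) <= perimeter T /\
    Cmod (boundary_int f T) <= 4 * Cmod (boundary_int f T').
Proof.
destruct T as [[a b] d]; intros Hf (Ha & Hb & Hd); simpl.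
assert (H1 := midpoint_disc c a b r Ha Hb).
assert (H2 := midpoint_disc c b d r Hb Hd).
assert (H3 := midpoint_disc c d a r Hd Ha).
assert (E := f_equal Cmod (triint_subdivision f c a b d r Hf Ha Hb Hd)); cbv zeta in E.
apply Cmod_quarter in E.
assert (N1 := Cmod_ge_0 (b - a)); assert (N2 := Cmod_ge_0 (d - b)).
assert (N3 := Cmod_ge_0 (a - d)).
assert (A1 : Cmod (midpoint a b - a) = Cmod (b - a) / 2)
  by (apply half_dist; unfold midpoint; rewrite half_C; field).
assert (A2 : Cmod (b - midpoint a b) = Cmod (b - a) / 2)
  by (apply half_dist; unfold midpoint; rewrite half_C; field).
assert (A3 : Cmod (midpoint b d - b) = Cmod (d - b) / 2)
  by (apply half_dist; unfold midpoint; rewrite half_C; field).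
assert (A4 : Cmod (d - midpoint b d) = Cmod (d - b) / 2)
  by (apply half_dist; unfold midpoint; rewrite half_C; field).
assert (A5 : Cmod (midpoint d a - d) = Cmod (a - d) / 2)
  by (apply half_dist; unfold midpoint; rewrite half_C; field).
assert (A6 : Cmod (a - midpoint d a) = Cmod (a - d) / 2)
  by (apply half_dist; unfold midpoint; rewrite half_C; field).
assert (B1 : Cmod (midpoint d a - midpoint a b) = Cmod (d - b) / 2)
  by (apply half_dist; unfold midpoint; rewrite half_C; field).
assert (B2 : Cmod (midpoint b d - midpoint a b) = Cmod (a - d) / 2)
  by (rewrite (Cmod_minus_sym a d); apply half_dist; unfold midpoint; rewrite half_C; field).
assert (B3 : Cmod (midpoint b d - midpoint d a) = Cmod (b - a) / 2)
  by (apply half_dist; unfold midpoint; rewrite half_C; field).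
assert (B1' := Cmod_minus_sym (midpoint d a) (midpoint a b)).
assert (B2' := Cmod_minus_sym (midpoint b d) (midpoint a b)).
assert (B3' := Cmod_minus_sym (midpoint b d) (midpoint d a)).
assert (A6' := Cmod_minus_sym a (midpoint d a)).
assert (Z : Cmod (a - a) = 0)
  by (replace (a - a)%C with (RtoC 0) by ring; apply Cmod_0).
destruct E as [E|[E|[E|E]]].
- exists (a, midpoint a b, midpoint d a); simpl; repeat split; auto; lra.
- exists (midpoint a b, b, midpoint b d); simpl; repeat split; auto; lra.
- exists (midpoint d a, midpoint b d, d); simpl; repeat split; auto; lra.
- exists (midpoint a b, midpoint b d, midpoint d a); simpl; repeat split; auto; lra.
Qed.

(** The sequence [x n - 2 * L / 2 ^ n] increases and [x n + 2 * L / 2 ^ n] decreases, since the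
    margin shrinks by exactly [L / 2 ^ n] at step [n]. The supremum of the first lies below every
    term of the second. *)
Lemma geometric_limit_R (x : nat -> R) (L : R) :
  (forall n, Rabs (x (S n) - x n) <= L / 2 ^ n) ->
  exists s, forall n, Rabs (s - x n) <= 2 * L / 2 ^ n.
Proof.
intros H.
assert (P2 : forall n, 0 < 2 ^ n) by (intros; apply pow_lt; lra).
assert (S1 : forall n, 2 * L / 2 ^ S n = L / 2 ^ n)
  by (intros n; simpl; field; generalize (P2 n); lra).
assert (Mlo : forall n k, x n - 2 * L / 2 ^ n <= x (n + k)%nat - 2 * L / 2 ^ (n + k)).
{ intros n k; induction k as [|k IH].
  - rewrite Nat.add_0_r; lra.
  - rewrite Nat.add_succ_r, S1; eapply Rle_trans; [exact IH|].
    specialize (H (n + k)%nat); apply Rabs_le_between in H; lra. }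
assert (Mhi : forall n k, x (n + k)%nat + 2 * L / 2 ^ (n + k) <= x n + 2 * L / 2 ^ n).
{ intros n k; induction k as [|k IH].
  - rewrite Nat.add_0_r; lra.
  - rewrite Nat.add_succ_r, S1; eapply Rle_trans; [|exact IH].
    specialize (H (n + k)%nat); apply Rabs_le_between in H; lra. }
assert (LH : forall n, 0 <= 2 * L / 2 ^ n).
{ intros n; specialize (H n); generalize (Rabs_pos (x (S n) - x n)).
  replace (2 * L / 2 ^ n) with (2 * (L / 2 ^ n)) by (unfold Rdiv; ring); lra. }
assert (LU : forall n m, x n - 2 * L / 2 ^ n <= x m + 2 * L / 2 ^ m).
{ intros n m.
  apply Rle_trans with (x (n + m)%nat - 2 * L / 2 ^ (n + m)); [apply Mlo|].
  apply Rle_trans with (x (n + m)%nat + 2 * L / 2 ^ (n + m));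
    [specialize (LH (n + m)%nat); lra|].
  rewrite Nat.add_comm; apply Mhi. }
destruct (completeness (fun y => exists n, y = x n - 2 * L / 2 ^ n)) as [s [Us Ls]].
- exists (x 0%nat + 2 * L / 2 ^ 0); intros y [n ->]; apply LU.
- now exists (x 0%nat - 2 * L / 2 ^ 0), 0%nat.
- exists s; intros n; apply Rabs_le_between; split.
  + enough (x n - 2 * L / 2 ^ n <= s) by lra; apply Us; now exists n.
  + enough (s <= x n + 2 * L / 2 ^ n) by lra; apply Ls; intros y [m ->]; apply LU.
Qed.

(** Limits are taken by components; the constant [4] comes from the real bound [2 * L] and the crude
    estimate [sqrt 2 <= 2]. *)
Lemma geometric_limit_C (a : nat -> C) (L : R) :
  (forall n, Cmod (a (S n) - a n) <= L / 2 ^ n) ->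
  exists s, forall n, Cmod (s - a n) <= 4 * L / 2 ^ n.
Proof.
intros H.
destruct (geometric_limit_R (fun n => fst (a n)) L) as [x Hx].
{ intros n; eapply Rle_trans; [|apply H].
  eapply Rle_trans; [apply Rmax_l|apply (Rmax_Cmod (a (S n) - a n)%C)]. }
destruct (geometric_limit_R (fun n => snd (a n)) L) as [y Hy].
{ intros n; eapply Rle_trans; [|apply H].
  eapply Rle_trans; [apply Rmax_r|apply (Rmax_Cmod (a (S n) - a n)%C)]. }
exists (x, y); intros n.
eapply Rle_trans; [apply Cmod_2Rmax|].
replace (4 * L / 2 ^ n) with (2 * (2 * L / 2 ^ n)) by (unfold Rdiv; ring).
specialize (Hx n); specialize (Hy n).
apply Rmult_le_compat.
- apply sqrt_pos.
- eapply Rle_trans; [|apply Rmax_l]; apply Rabs_pos.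
- rewrite <- (sqrt_square 2) at 2 by lra; apply sqrt_le_1; lra.
- apply Rmax_lub; simpl; assumption.
Qed.

Lemma eventually_small (K d : R) : 0 < d -> exists n, K / 2 ^ n < d.
Proof.
intros Hd.
destruct (Pow_x_infinity 2 ltac:(rewrite Rabs_pos_eq; lra) (Rabs K / d + 1)) as [n Hn].
exists n; specialize (Hn n (Nat.le_refl n)).
assert (P2 : 0 < 2 ^ n) by (apply pow_lt; lra).
rewrite Rabs_pos_eq in Hn by lra.
apply Rmult_lt_reg_r with (2 ^ n); [easy|].
replace (K / 2 ^ n * 2 ^ n) with K by (field; lra).
apply Rle_lt_trans with (Rabs K); [apply Rle_abs|].
apply Rlt_le_trans with (d * (Rabs K / d + 1)); [|apply Rmult_le_compat_l; lra].
replace (d * (Rabs K / d + 1)) with (Rabs K + d) by (field; lra); lra.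
Qed.

(** A primitive of the affine function [u + l * (z - c)]; the remainder is exactly
    [l * (w - z) * (w - z) / 2]. *)
Lemma cderiv_quadratic (u l c z : C) :
  cderiv (fun w => u * w + l * / 2 * (w - c) * (w - c))%C z (u + l * (z - c)).
Proof.
intros eps He; assert (Hl := Cmod_ge_0 l).
exists (eps / (1 + Cmod l)); split; [apply Rdiv_lt_0_compat; lra|].
intros w Hw.
match goal with |- Cmod ?x <= _ => replace x with ((/ 2)%R * (l * (w - z) * (w - z)))%C
  by (rewrite half_C; field) end.
rewrite !Cmod_mult, Cmod_R, Rabs_pos_eq by lra.
apply Rmult_lt_compat_r with (r := 1 + Cmod l) in Hw; [|lra].
replace (eps / (1 + Cmod l) * (1 + Cmod l)) with eps in Hw by (field; lra).
assert (Hz := Cmod_ge_0 (w - z)).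
rewrite <- Rmult_assoc; apply Rmult_le_compat_r; nra.
Qed.

(** After [n] bisections the perimeter is [L / 2 ^ n] and the integral has lost at most the factor
    [4 ^ n]. Near the limit point [s], [f] is its affine approximation up to [eps] times the
    distance, and an affine function has a primitive, so the small integral is
    [O(eps * L ^ 2 / 4 ^ n)]: the powers of [4] cancel. *)
Lemma goursat (f : C -> C) (c a b d : C) (r : R) :
  (forall z, Cmod (z - c) <= r -> exists l, cderiv f z l) ->
  Cmod (a - c) <= r -> Cmod (b - c) <= r -> Cmod (d - c) <= r ->
  triint f a b d = 0.
Proof.
intros Hf Ha Hb Hd.
assert (Cf : forall z, Cmod (z - c) <= r -> ccont f z).
{ intros z Hz; destruct (Hf z Hz) as [l Hl]; now apply cderiv_ccont in Hl. }
pose (T0 := (a, b, d) : triangle).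
(* A total choice function for bisection; outside the disc it returns [T] itself and the implication
   is vacuous. *)
assert (step : forall T, {T' | in_disc c r T -> in_disc c r T' /\ perimeter T' = perimeter T / 2 /\
    Cmod (apex T' - apex T) <= perimeter T /\
    Cmod (boundary_int f T) <= 4 * Cmod (boundary_int f T')}).
{ intros T; apply constructive_indefinite_description.
  destruct (classic (in_disc c r T)) as [HT|HT].
  - destruct (bisect f c r T Cf HT) as [T' H']; exists T'; auto.
  - exists T; easy. }
pose (T := fix T n := match n with O => T0 | S k => proj1_sig (step (T k)) end).
assert (TS : forall n, T (S n) = proj1_sig (step (T n))) by easy.
assert (G : forall n, in_disc c r (T n)).
{ induction n as [|n IH]; [easy|].
  rewrite TS; destruct (step (T n)) as [T' H']; simpl; now apply H'. }
pose (L := perimeter T0).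
assert (P2 : forall n, 0 < 2 ^ n) by (intros; apply pow_lt; lra).
assert (Per : forall n, perimeter (T n) = L / 2 ^ n).
{ induction n as [|n IH]; [unfold L; simpl; field|].
  rewrite TS; destruct (step (T n)) as [T' H']; simpl.
  destruct (H' (G n)) as (_ & -> & _); rewrite IH; field; generalize (P2 n); lra. }
assert (Apex : forall n, Cmod (apex (T (S n)) - apex (T n)) <= L / 2 ^ n).
{ intros n; rewrite <- Per, TS; destruct (step (T n)) as [T' H']; simpl; now apply H'. }
assert (Big : forall n, Cmod (boundary_int f T0) <= 4 ^ n * Cmod (boundary_int f (T n))).
{ induction n as [|n IH]; [simpl; lra|].
  eapply Rle_trans; [exact IH|].
  rewrite TS; destruct (step (T n)) as [T' H']; simpl.
  destruct (H' (G n)) as (_ & _ & _ & H4).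
  rewrite (Rmult_comm 4), Rmult_assoc; apply Rmult_le_compat_l; [|easy].
  apply pow_le; lra. }
destruct (geometric_limit_C _ _ Apex) as [s Hs].
(* The closed disc contains the limit of the apexes, so [f] is differentiable at [s]. *)
assert (Ds : Cmod (s - c) <= r).
{ apply le_epsilon; intros e He.
  destruct (eventually_small (4 * L) e He) as [n Hn].
  replace (s - c)%C with ((s - apex (T n)) + (apex (T n) - c))%C by ring.
  eapply Rle_trans; [apply Cmod_triangle|].
  assert (Cmod (apex (T n) - c) <= r)
    by (generalize (G n); destruct (T n) as [[? ?] ?]; simpl; tauto).
  specialize (Hs n); lra. }
destruct (Hf s Ds) as [l Hl].
change (boundary_int f T0 = 0).
(* A point on the boundary of the [n]-th triangle is within [L / 2 ^ n] of its apex, which is within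
   [4 * L / 2 ^ n] of [s]; this gives the [5 * L], and the other factor [L] is the perimeter. *)
apply (Cmod_small_eq_0 _ (5 * L * L)); intros eps He.
destruct (Hl eps He) as [dl [Hdl Happ]].
destruct (eventually_small (5 * L) dl Hdl) as [n Hn].
assert (Key : Cmod (boundary_int f (T n)) <= eps * (5 * L / 2 ^ n) * (L / 2 ^ n)).
{ generalize (G n) (Per n) (Hs n); destruct (T n) as [[u v] w]; simpl.
  intros (Hu & Hv & Hw) HP Hsu.
  pose (A' := fun z : C => (f s + l * (z - s))%C).
  pose (A := fun z : C => (f s * z + l * / 2 * (z - s) * (z - s))%C).
  assert (N1 := Cmod_ge_0 (v - u)); assert (N2 := Cmod_ge_0 (w - v)).
  assert (N3 := Cmod_ge_0 (u - w)).
  assert (Piece : forall x y, Cmod (x - c) <= r -> Cmod (y - c) <= r ->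
    Cmod (x - u) <= L / 2 ^ n -> Cmod (y - u) <= L / 2 ^ n ->
    Cmod (segint f x y - (A y - A x)) <= eps * (5 * L / 2 ^ n) * Cmod (y - x)).
  { intros x y Hx Hy Hxu Hyu.
    assert (Aux : forall t, 0 <= t <= 1 -> Cmod (seg x y t - s) <= 5 * L / 2 ^ n).
    { intros t Ht.
      replace (5 * L / 2 ^ n) with (L / 2 ^ n + 4 * L / 2 ^ n) by (unfold Rdiv; ring).
      eapply Rle_trans; [apply (Cmod_dist_triangle _ u)|].
      apply Rplus_le_compat; [now apply seg_disc|now rewrite Cmod_minus_sym]. }
    apply (segint_approx f A A'); intros t Ht.
    - apply Cf; now apply seg_disc.
    - unfold A'; eapply cderiv_ccont.
      intros e1 He1; exists 1; split; [lra|]; intros z _.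
      instantiate (1 := l).
      match goal with |- Cmod ?x <= _ => replace x with (RtoC 0) by ring end.
      rewrite Cmod_0; apply Rmult_le_pos; [lra|apply Cmod_ge_0].
    - apply cderiv_quadratic.
    - unfold A'.
      replace (f (seg x y t) - (f s + l * (seg x y t - s)))%C
        with (f (seg x y t) - f s - l * (seg x y t - s))%C by ring.
      eapply Rle_trans; [apply Happ; eapply Rle_lt_trans; [now apply Aux|exact Hn]|].
      apply Rmult_le_compat_l; [lra|now apply Aux]. }
  assert (Z : Cmod (u - u) <= L / 2 ^ n)
    by (replace (u - u)%C with (RtoC 0) by ring; rewrite Cmod_0; lra).
  assert (Huw := Cmod_minus_sym u w).
  assert (Q1 := Piece u v Hu Hv Z ltac:(lra)).
  assert (Q2 := Piece v w Hv Hw ltac:(lra) ltac:(lra)).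
  assert (Q3 := Piece w u Hw Hu ltac:(lra) Z).
  unfold triint.
  replace (segint f u v + segint f v w + segint f w u)%C with
    ((segint f u v - (A v - A u)) + (segint f v w - (A w - A v)) + (segint f w u - (A u - A w)))%C
    by ring.
  eapply Rle_trans; [apply Cmod_triangle|].
  eapply Rle_trans; [apply Rplus_le_compat_r, Cmod_triangle|].
  rewrite <- HP; lra. }
eapply Rle_trans; [apply (Big n)|].
assert (Q4 : 0 < 4 ^ n) by (apply pow_lt; lra).
apply Rmult_le_compat_l with (r := 4 ^ n) in Key; [|lra].
eapply Rle_trans; [exact Key|right].
replace (4 ^ n) with (2 ^ n * 2 ^ n) by (rewrite <- Rpow_mult_distr; f_equal; ring).
field; generalize (P2 n); lra.
Qed.

(** Goursat's lemma for the triangle [c], [z], [w] turns the increment of [segint f c] into the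
    integral from [z] to [w], along which [f] is within [eps] of [f z]. *)
Lemma primitive_disc (f : C -> C) (c : C) (r : R) :
  (forall z, Cmod (z - c) <= r -> exists l, cderiv f z l) ->
  forall z, Cmod (z - c) < r -> cderiv (segint f c) z (f z).
Proof.
intros Hf z Hz eps He.
assert (Cf : forall w, Cmod (w - c) <= r -> ccont f w).
{ intros w Hw; destruct (Hf w Hw) as [l Hl]; now apply cderiv_ccont in Hl. }
destruct (Cf z ltac:(lra) eps He) as [d [Hd H]].
exists (Rmin d (r - Cmod (z - c))); split; [apply Rmin_glb_lt; lra|].
intros w Hw.
assert (Hw1 := Rlt_le_trans _ _ _ Hw (Rmin_l _ _)).
assert (Hw2 := Rlt_le_trans _ _ _ Hw (Rmin_r _ _)).
assert (Hwc : Cmod (w - c) <= r).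
{ eapply Rle_trans; [apply (Cmod_dist_triangle _ z)|lra]. }
assert (Hcc : Cmod (c - c) <= r).
{ replace (c - c)%C with (RtoC 0) by ring; rewrite Cmod_0.
  generalize (Cmod_ge_0 (z - c)); lra. }
assert (E := goursat f c c z w r Hf Hcc ltac:(lra) Hwc).
unfold triint in E.
rewrite (segint_swap f c w) in E by (intros; apply Cf; now apply seg_disc).
assert (E2 : (segint f c w - segint f c z)%C = segint f z w).
{ replace (segint f c w) with
    (segint f c z + segint f z w - (segint f c z + segint f z w + - segint f c w))%C by ring.
  rewrite E; ring. }
rewrite E2.
replace (f z * (w - z))%C with (f z * w - f z * z)%C by ring.
apply (segint_approx f (fun u => f z * u)%C (fun _ => f z)); intros t Ht.
- apply Cf; apply seg_disc; [lra|easy|easy].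
- intros e He1; exists 1; split; [lra|]; intros; replace (f z - f z)%C with (RtoC 0) by ring.
  rewrite Cmod_0; lra.
- intros e He1; exists 1; split; [lra|]; intros.
  match goal with |- Cmod ?x <= _ => replace x with (RtoC 0) by ring end.
  rewrite Cmod_0; apply Rmult_le_pos; [lra|apply Cmod_ge_0].
- apply H.
  eapply Rle_lt_trans; [|exact Hw1].
  apply seg_disc; [|lra|easy].
  replace (z - z)%C with (RtoC 0) by ring; rewrite Cmod_0; apply Cmod_ge_0.
Qed.

(** * Integrals over a circle depending on a complex variable *)

Lemma ccont_const (l z : C) : ccont (fun _ => l) z.
Proof.
intros e He; exists 1; split; [lra|]; intros.
replace (l - l)%C with (RtoC 0) by ring; rewrite Cmod_0; lra.
Qed.

Lemma cderiv_linear (l z : C) : cderiv (fun w => l * w)%C z l.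
Proof.
intros e He; exists 1; split; [lra|]; intros.
match goal with |- Cmod ?x <= _ => replace x with (RtoC 0) by ring end.
rewrite Cmod_0; apply Rmult_le_pos; [lra|apply Cmod_ge_0].
Qed.

(** A mean value inequality: [F b - F a] is the integral of [F'] along the segment, compared with
    that of the constant [l]. *)
Lemma cderiv_increment (F F' : C -> C) (a b l : C) (M : R) :
  (forall t, 0 <= t <= 1 -> ccont F' (seg a b t)) ->
  (forall t, 0 <= t <= 1 -> cderiv F (seg a b t) (F' (seg a b t))) ->
  (forall t, 0 <= t <= 1 -> Cmod (F' (seg a b t) - l) <= M) ->
  Cmod (F b - F a - l * (b - a)) <= M * Cmod (b - a).
Proof.
intros H1 H2 H3.
assert (E : segint (fun _ => l) a b = (l * b - l * a)%C).
{ enough (E : (segint (fun _ => l) a b - (l * b - l * a))%C = 0).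
  { replace (segint (fun _ => l) a b) with
      ((segint (fun _ => l) a b - (l * b - l * a)) + (l * b - l * a))%C by ring.
    rewrite E; ring. }
  apply (Cmod_small_eq_0 _ 0); intros eps _.
  rewrite Rmult_0_l, <- (Rmult_0_l (Cmod (b - a))).
  apply (segint_approx _ (fun w => l * w)%C (fun _ => l)); intros.
  - apply ccont_const.
  - apply ccont_const.
  - apply cderiv_linear.
  - replace (l - l)%C with (RtoC 0) by ring; rewrite Cmod_0; lra. }
assert (K : Cmod (segint (fun _ => l) a b - (F b - F a)) <= M * Cmod (b - a)).
{ apply (segint_approx _ F F'); auto; intros; [apply ccont_const|].
  rewrite Cmod_minus_sym; auto. }
rewrite E, Cmod_minus_sym in K.
replace (F b - F a - l * (b - a))%C with (F b - F a - (l * b - l * a))%C by ring.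
exact K.
Qed.

(** Continuity of [G] at [p t] yields a radius that serves all parameters near [t]; compactness of
    [[a, b]] makes it uniform. The margins [d1 / 3] for the curve and [d1 / 2] for [s] add up to
    less than [d1]. *)
Lemma uniform_modulus (G : C -> C) (p : R -> C) (a b eps : R) :
  (forall t, continuous (U := C_UniformSpace) p t) ->
  (forall t, ccont G (p t)) -> 0 < eps ->
  exists d, 0 < d /\ forall t s, a <= t <= b -> Cmod s < d ->
    Cmod (G (p t + s)%C - G (p t)) <= eps.
Proof.
intros Hp HG He.
assert (L : forall t, {d : posreal | forall u s, Rabs (u - t) < d -> Cmod s < d ->
  Cmod (G (p u + s)%C - G (p u)) <= eps}).
{ intros t; apply constructive_indefinite_description.
  destruct (HG t (eps / 2) ltac:(lra)) as [d1 [Hd1 H1]].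
  assert (Hd : 0 < d1 / 2) by lra.
  destruct (proj1 (continuous_Cmod p t) (Hp t) (d1 / 3) ltac:(lra)) as [d2 H2].
  assert (H3 : 0 < Rmin (d1 / 2) d2) by (apply Rmin_glb_lt; [easy|apply cond_pos]).
  exists (mkposreal _ H3); intros u s Hu Hs; simpl in Hu, Hs.
  assert (Hpu : Cmod (p u - p t) <= d1 / 3).
  { apply H2; eapply Rlt_le_trans; [exact Hu|apply Rmin_r]. }
  assert (Hs' := Rlt_le_trans _ _ _ Hs (Rmin_l _ _)).
  eapply Rle_trans; [apply (Cmod_dist_triangle _ (G (p t)))|].
  rewrite (Cmod_minus_sym (G (p t))).
  replace eps with (eps / 2 + eps / 2) by field.
  apply Rplus_le_compat; apply H1; [|lra].
  replace (p u + s - p t)%C with ((p u - p t) + s)%C by ring.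
  eapply Rle_lt_trans; [apply Cmod_triangle|lra]. }
destruct (compactness_value_1d a b (fun t => proj1_sig (L t))) as [d Hd].
exists d; split; [apply cond_pos|]; intros u s Hu Hs.
(* Compactness provides the covering point under a double negation, so the inequality is proved by
   contradiction. *)
apply Rnot_lt_le; intros K; apply (Hd u Hu); intros [t [_ [Ht Hdt]]].
destruct (L t) as [dt Hdt']; simpl in *.
specialize (Hdt' u s Ht ltac:(lra)); lra.
Qed.

Definition oint (f : R -> C) : C := RInt (V := VC) f 0 (2 * PI).

Lemma is_RInt_oint (f : R -> C) :
  (forall t, continuous (U := C_UniformSpace) f t) ->
  is_RInt (V := C_R_NormedModule) f 0 (2 * PI) (oint f).
Proof.
intros H; apply (RInt_correct (V := VC)), (ex_RInt_continuous (V := VC)); auto.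
Qed.

Lemma oint_bound (f : R -> C) (M : R) (l : C) :
  is_RInt (V := C_R_NormedModule) f 0 (2 * PI) l ->
  (forall t, 0 <= t <= 2 * PI -> Cmod (f t) <= M) ->
  Cmod l <= 2 * PI * M.
Proof.
intros H HM; rewrite <- norm_Cmod.
replace (2 * PI * M) with ((2 * PI - 0) * M) by ring.
refine (norm_RInt_le_const _ _ _ _ _ _ _ H); [generalize PI_RGT_0; lra|].
intros t Ht; rewrite norm_Cmod; auto.
Qed.

Lemma continuous_path_comp (f : C -> C) (g : R -> C) (t : R) :
  continuous (U := C_UniformSpace) g t -> ccont f (g t) ->
  continuous (U := C_UniformSpace) (fun s => f (g s)) t.
Proof.
intros Hg Hf; apply (continuous_comp g f t Hg); now apply ccont_continuous.
Qed.

(** The integral is only real-linear by construction; the complex factor is handled by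
    components. *)
Lemma is_RInt_Cmult_r (f : R -> C) (a b : R) (l h : C) :
  is_RInt (V := C_R_NormedModule) f a b l ->
  is_RInt (V := C_R_NormedModule) (fun t => f t * h)%C a b (l * h)%C.
Proof.
intros K.
assert (K1 := is_RInt_fct_extend_fst (U := R_NormedModule) (V := R_NormedModule) _ _ _ _ K).
assert (K2 := is_RInt_fct_extend_snd (U := R_NormedModule) (V := R_NormedModule) _ _ _ _ K).
apply (is_RInt_fct_extend_pair (U := R_NormedModule) (V := R_NormedModule)).
- assert (K3 := is_RInt_minus _ _ _ _ _ _ (is_RInt_scal _ _ _ (fst h) _ K1)
    (is_RInt_scal _ _ _ (snd h) _ K2)).
  match goal with |- is_RInt _ _ _ ?v => replace v with (minus (scal (fst h) (fst l)) (scal (snd h) (snd l)))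
    by (unfold minus, plus, opp, scal; simpl; unfold mult; simpl; ring) end.
  eapply is_RInt_ext; [|exact K3].
  intros t _; unfold minus, plus, opp, scal; simpl; unfold mult; simpl; ring.
- assert (K3 := is_RInt_plus _ _ _ _ _ _ (is_RInt_scal _ _ _ (snd h) _ K1)
    (is_RInt_scal _ _ _ (fst h) _ K2)).
  match goal with |- is_RInt _ _ _ ?v => replace v with (plus (scal (snd h) (fst l)) (scal (fst h) (snd l)))
    by (unfold minus, plus, opp, scal; simpl; unfold mult; simpl; ring) end.
  eapply is_RInt_ext; [|exact K3].
  intros t _; unfold minus, plus, opp, scal; simpl; unfold mult; simpl; ring.
Qed.

Section ContourIntegral.

Variables (c : C) (rho r : R) (g k w : R -> C) (x0 : C).
Hypothesis Hr : rho < r.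
Hypothesis Cg : forall t, continuous (U := C_UniformSpace) g t.
Hypothesis Ck : forall t, continuous (U := C_UniformSpace) k t.
Hypothesis Cw : forall t, continuous (U := C_UniformSpace) w t.
Hypothesis Bk : forall t, Cmod (k t) = 1.
Hypothesis Bw : forall t, Cmod (w t) = 1.
Hypothesis Hrho : forall t, Cmod (g t + x0 * k t - c) <= rho.

(** A family of curves affine in [x], serving two purposes: with [k] constant, [x] moves the centre
    of a circle of fixed radius; with [g] constant, [x] is the radius about a fixed centre. The
    margin [r - rho] keeps nearby curves inside the disc. *)
Let p (x : C) (t : R) : C := (g t + x * k t)%C.

Lemma parameter_curve_continuous x t : continuous (U := C_UniformSpace) (p x) t.
Proof.
apply continuous_Cplus; [apply Cg|].
apply continuous_Cmult; [apply (continuous_const (V := C_UniformSpace))|apply Ck].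
Qed.

Lemma parameter_curve_disc x t : Cmod (x - x0) < r - rho -> Cmod (p x t - c) < r.
Proof.
intros H; unfold p.
replace (g t + x * k t - c)%C with ((g t + x0 * k t - c) + (x - x0) * k t)%C by ring.
eapply Rle_lt_trans; [apply Cmod_triangle|].
rewrite Cmod_mult, Bk; generalize (Hrho t); lra.
Qed.

Lemma parameter_integrand_continuous (F : C -> C) x t :
  (forall z, Cmod (z - c) < r -> ccont F z) -> Cmod (x - x0) < r - rho ->
  continuous (U := C_UniformSpace) (fun s => F (p x s) * w s)%C t.
Proof.
intros HF Hx; apply continuous_Cmult; [|apply Cw].
apply continuous_path_comp; [apply parameter_curve_continuous|].
now apply HF, parameter_curve_disc.
Qed.

Lemma parameter_integral_ccont (F : C -> C) :
  (forall z, Cmod (z - c) < r -> ccont F z) ->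
  ccont (fun x => oint (fun t => F (p x t) * w t)%C) x0.
Proof.
intros HF eps He.
assert (Z : Cmod (x0 - x0) < r - rho)
  by (replace (x0 - x0)%C with (RtoC 0) by ring; rewrite Cmod_0; lra).
assert (HPI := PI_RGT_0).
destruct (uniform_modulus F (p x0) 0 (2 * PI) (eps / (2 * PI))) as [d [Hd H]].
{ apply parameter_curve_continuous. }
{ intros t; now apply HF, parameter_curve_disc. }
{ apply Rdiv_lt_0_compat; lra. }
exists (Rmin d (r - rho)); split; [apply Rmin_glb_lt; lra|]; intros x Hx.
assert (Hx1 := Rlt_le_trans _ _ _ Hx (Rmin_l _ _)).
assert (Hx2 := Rlt_le_trans _ _ _ Hx (Rmin_r _ _)).
replace eps with (2 * PI * (eps / (2 * PI))) by (field; lra).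
refine (oint_bound _ _ _ (is_RInt_minus _ _ _ _ _ _
  (is_RInt_oint _ (fun t => parameter_integrand_continuous F x t HF Hx2))
  (is_RInt_oint _ (fun t => parameter_integrand_continuous F x0 t HF Z))) _).
intros t Ht.
  match goal with |- Cmod ?u <= _ =>
    replace u with ((F (p x0 t + (x - x0) * k t) - F (p x0 t)) * w t)%C end.
  2: { match goal with |- _ = ?v => change v with
         (F (p x t) * w t - F (p x0 t) * w t)%C end.
       replace (p x t) with (p x0 t + (x - x0) * k t)%C by (unfold p; ring); ring. }
  rewrite Cmod_mult, Bw, Rmult_1_r; apply H; [easy|].
  now rewrite Cmod_mult, Bk, Rmult_1_r.
Qed.

(** Differentiation under the integral sign. The mean value inequality bounds the remainder of the
    integrand by the oscillation of [F'] near the curve [p x0], which is uniformly small in [t]. *)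
Lemma parameter_integral_cderiv (F F' : C -> C) :
  (forall z, Cmod (z - c) < r -> cderiv F z (F' z)) ->
  (forall z, Cmod (z - c) < r -> ccont F' z) ->
  cderiv (fun x => oint (fun t => F (p x t) * w t)%C) x0
    (oint (fun t => F' (p x0 t) * (k t * w t))%C).
Proof.
intros HF HF' eps He.
assert (CF : forall z, Cmod (z - c) < r -> ccont F z)
  by (intros z Hz; now apply (cderiv_ccont F z (F' z)), HF).
assert (Z : Cmod (x0 - x0) < r - rho)
  by (replace (x0 - x0)%C with (RtoC 0) by ring; rewrite Cmod_0; lra).
assert (HPI := PI_RGT_0).
destruct (uniform_modulus F' (p x0) 0 (2 * PI) (eps / (2 * PI))) as [d [Hd H]].
{ apply parameter_curve_continuous. }
{ intros t; now apply HF', parameter_curve_disc. }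
{ apply Rdiv_lt_0_compat; lra. }
exists (Rmin d (r - rho)); split; [apply Rmin_glb_lt; lra|]; intros x Hx.
assert (Hx1 := Rlt_le_trans _ _ _ Hx (Rmin_l _ _)).
assert (Hx2 := Rlt_le_trans _ _ _ Hx (Rmin_r _ _)).
pose (h := (x - x0)%C).
assert (C1 : forall t, continuous (U := C_UniformSpace)
  (fun s => F' (p x0 s) * (k s * w s))%C t).
{ intros t; apply continuous_Cmult; [|apply continuous_Cmult; [apply Ck|apply Cw]].
  apply continuous_path_comp; [apply parameter_curve_continuous|].
  now apply HF', parameter_curve_disc. }
assert (I1 : is_RInt (V := C_R_NormedModule) (fun s => F' (p x0 s) * (k s * w s) * h)%C
  0 (2 * PI) (oint (fun t => F' (p x0 t) * (k t * w t))%C * h)%C).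
{ now apply is_RInt_Cmult_r, is_RInt_oint. }
replace (eps * Cmod (x - x0)) with (2 * PI * (eps / (2 * PI) * Cmod h))
  by (unfold h; field; lra).
refine (oint_bound _ _ _ (is_RInt_minus _ _ _ _ _ _ (is_RInt_minus _ _ _ _ _ _
  (is_RInt_oint _ (fun t => parameter_integrand_continuous F x t CF Hx2))
  (is_RInt_oint _ (fun t => parameter_integrand_continuous F x0 t CF Z))) I1) _).
intros t Ht.
  match goal with |- Cmod ?u <= _ =>
    replace u with ((F (p x t) - F (p x0 t) - F' (p x0 t) * (p x t - p x0 t)) * w t)%C end.
  2: { match goal with |- _ = ?v => change v with
         (F (p x t) * w t - F (p x0 t) * w t - F' (p x0 t) * (k t * w t) * h)%C end.
       unfold h, p; ring. }
  rewrite Cmod_mult, Bw, Rmult_1_r.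
  assert (E : Cmod h = Cmod (p x t - p x0 t)).
  { replace (p x t - p x0 t)%C with (h * k t)%C by (unfold h, p; ring).
    now rewrite Cmod_mult, Bk, Rmult_1_r. }
  (* As [p] is affine in its parameter, the segment from [p x0 t] to [p x t] consists of points
     [p y t] with [y] between [x0] and [x]. *)
  assert (S : forall s, 0 <= s <= 1 -> exists y,
    Cmod (y - x0) <= Cmod h /\ seg (p x0 t) (p x t) s = p y t).
  { intros s Hs; exists (seg x0 x s); split.
    - apply seg_disc; [|unfold h; lra|easy].
      replace (x0 - x0)%C with (RtoC 0) by ring; rewrite Cmod_0; apply Cmod_ge_0.
    - unfold seg, p; ring. }
  rewrite E; apply (cderiv_increment F F'); intros s Hs;
    destruct (S s Hs) as [y [Hy Ey]]; rewrite Ey.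
  + apply HF', parameter_curve_disc; unfold h in Hy; lra.
  + apply HF, parameter_curve_disc; unfold h in Hy; lra.
  + replace (p y t) with (p x0 t + (y - x0) * k t)%C by (unfold p; ring).
    apply H; [easy|].
    rewrite Cmod_mult, Bk, Rmult_1_r; unfold h in Hy; lra.
Qed.

End ContourIntegral.

(** * Derivatives are complex differentiable *)

(** The equation [u = s * u'] makes the derivative of [u s / s] vanish, so this quotient is constant
    on [(0, r]]; since [u 0 = 0], its limit at [0] is [m 0]. *)
Lemma homogeneous_of_degree_one (u m : R -> R) (r : R) :
  0 < r -> (forall s, 0 <= s <= r -> is_derive u s (m s)) ->
  (forall s, 0 <= s <= r -> u s = s * m s) -> u r = r * m 0.
Proof.
intros Hr Du Eu.
assert (K : forall e, 0 < e < r -> u e / e = u r / r).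
{ intros e He; apply (eq_is_derive (V := R_NormedModule) (fun s => u s / s) e r); [|lra].
  intros t Ht; assert (D := Du t ltac:(lra)); assert (E := Eu t ltac:(lra)).
  assert (D2 := is_derive_div u (fun s => s) t _ 1 D (is_derive_id t) ltac:(lra)).
  replace (zero : R_NormedModule) with ((m t * t - u t * 1) / t ^ 2); [exact D2|].
  rewrite E; unfold zero; simpl; field; lra. }
assert (D0 : derivable_pt_lim u 0 (m 0)) by (apply is_derive_Reals, Du; lra).
assert (U0 : u 0 = 0) by (rewrite Eu; lra).
enough (H : u r / r = m 0) by (rewrite <- H; field; lra).
apply cond_eq; intros eps He.
destruct (D0 eps He) as [d Hd].
assert (Hdp := cond_pos d).
pose (h := Rmin d r / 2).
assert (Hh : 0 < h < Rmin d r).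
{ assert (0 < Rmin d r) by now apply Rmin_glb_lt. unfold h; lra. }
assert (h < d) by (generalize (Rmin_l d r); lra).
assert (h < r) by (generalize (Rmin_r d r); lra).
specialize (Hd h ltac:(lra) ltac:(rewrite Rabs_pos_eq; lra)).
rewrite Rplus_0_l, U0, Rminus_0_r, K in Hd by lra; exact Hd.
Qed.

(** * The Cauchy integral for the derivative *)

Definition cis (t : R) : C := (cos t, sin t).
Definition cis_bar (t : R) : C := (cos t, - sin t).

Lemma cis_bar_inv (t : R) : (cis t * cis_bar t)%C = 1.
Proof.
generalize (sin2_cos2 t); unfold Rsqr; intros H.
apply injective_projections; simpl; [|ring].
rewrite <- H; ring.
Qed.

Lemma Cmod_cis (t : R) : Cmod (cis t) = 1.
Proof.
unfold Cmod, cis; simpl; transitivity (sqrt 1); [f_equal|apply sqrt_1].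
generalize (sin2_cos2 t); unfold Rsqr; lra.
Qed.

Lemma Cmod_cis_bar (t : R) : Cmod (cis_bar t) = 1.
Proof.
unfold Cmod, cis_bar; simpl; transitivity (sqrt 1); [f_equal|apply sqrt_1].
generalize (sin2_cos2 t); unfold Rsqr; lra.
Qed.

Lemma continuous_cis (t : R) : continuous (U := C_UniformSpace) cis t.
Proof.
apply continuous_pair; [apply continuous_cos|apply continuous_sin].
Qed.

Lemma continuous_cis_bar (t : R) : continuous (U := C_UniformSpace) cis_bar t.
Proof.
apply continuous_pair; [apply continuous_cos|].
apply (continuous_opp (V := R_NormedModule)), continuous_sin.
Qed.

Lemma continuous_Cconst (l : C) (t : R) : continuous (U := C_UniformSpace) (fun _ : R => l) t.
Proof. apply continuous_const. Qed.

(** Up to the factor [r / i], the contour integral of [F w / (w - z) ^ 2] over the circle of radius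
    [r] about [z]. The factor [1] keeps the shape [g t + x * k t] of the parametrised curves. *)
Definition circle_int (F : C -> C) (r : R) (z : C) : C :=
  oint (fun t => F (r * cis t + z * 1) * cis_bar t)%C.

Lemma circle_int_shift (r : R) (z c : C) (t : R) :
  0 <= r -> Cmod (r * cis t + z * 1 - c) <= Cmod (z - c) + r.
Proof.
intros Hr; replace (r * cis t + z * 1 - c)%C with ((z - c) + r * cis t)%C by ring.
eapply Rle_trans; [apply Cmod_triangle|].
rewrite Cmod_scal_R, Cmod_cis, Rabs_pos_eq; lra.
Qed.

Lemma circle_int_ccont (F : C -> C) (c z : C) (r R0 : R) :
  0 <= r -> Cmod (z - c) + r < R0 ->
  (forall z, Cmod (z - c) < R0 -> ccont F z) -> ccont (circle_int F r) z.
Proof.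
intros Hr Hz HF.
apply (parameter_integral_ccont c (Cmod (z - c) + r) R0 (fun t => r * cis t)%C
  (fun _ => 1) cis_bar z Hz); auto.
- intros t; apply continuous_Cmult; [apply continuous_Cconst|apply continuous_cis].
- intros t; apply continuous_Cconst.
- apply continuous_cis_bar.
- intros _; apply Cmod_1.
- apply Cmod_cis_bar.
- intros t; now apply circle_int_shift.
Qed.

Lemma oint_ext (f g : R -> C) : (forall t, f t = g t) -> oint f = oint g.
Proof. intros H; apply (RInt_ext (V := VC)); intros; apply H. Qed.

Lemma circle_int_cderiv (F F' : C -> C) (c z : C) (r R0 : R) :
  0 <= r -> Cmod (z - c) + r < R0 ->
  (forall z, Cmod (z - c) < R0 -> cderiv F z (F' z)) ->
  (forall z, Cmod (z - c) < R0 -> ccont F' z) ->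
  cderiv (circle_int F r) z (circle_int F' r z).
Proof.
intros Hr Hz HF HF'.
assert (E : circle_int F' r z =
  oint (fun t => F' (r * cis t + z * 1) * (1 * cis_bar t))%C)
  by (apply oint_ext; intros; ring).
rewrite E.
apply (parameter_integral_cderiv c (Cmod (z - c) + r) R0 (fun t => r * cis t)%C
  (fun _ => 1) cis_bar z Hz); auto.
- intros t; apply continuous_Cmult; [apply continuous_Cconst|apply continuous_cis].
- intros t; apply continuous_Cconst.
- apply continuous_cis_bar.
- intros _; apply Cmod_1.
- apply Cmod_cis_bar.
- intros t; now apply circle_int_shift.
Qed.

Lemma oint_const (l : C) : oint (fun _ => l) = ((2 * PI)%R * l)%C.
Proof.
unfold oint; rewrite (RInt_const (V := VC)).
match goal with |- scal ?x _ = _ => replace x with (2 * PI) by ring end.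
exact (scal_R_Cmult (2 * PI) l).
Qed.

(** Cauchy's formula for [F' z], obtained by varying the radius: [P s] is the integral at radius
    [s], [M s] its derivative, and [P s = s * M s] forces [P r = r * M 0], where the integrand of
    [M 0] is the constant [F' z]. *)
Lemma circle_int_eq (F F' : C -> C) (c z : C) (r R0 : R) :
  0 < r -> Cmod (z - c) + r < R0 ->
  (forall z, Cmod (z - c) < R0 -> cderiv F z (F' z)) ->
  (forall z, Cmod (z - c) < R0 -> ccont F' z) ->
  circle_int F r z = ((2 * PI * r)%R * F' z)%C.
Proof.
intros Hr Hz HF HF'.
pose (P := fun x : C => oint (fun t => F (z + x * cis t) * cis_bar t)%C).
pose (M := fun s : R => oint (fun t => F' (z + s * cis t) * (cis t * cis_bar t))%C).
assert (Disc : forall s t, 0 <= s <= r -> Cmod (z + s * cis t - c) <= Cmod (z - c) + r).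
{ intros s t Hs; replace (z + s * cis t - c)%C with ((z - c) + s * cis t)%C by ring.
  eapply Rle_trans; [apply Cmod_triangle|].
  rewrite Cmod_scal_R, Cmod_cis, Rabs_pos_eq; lra. }
assert (DP : forall s : R, 0 <= s <= r -> cderiv P s (M s)).
{ intros s Hs.
  apply (parameter_integral_cderiv c (Cmod (z - c) + r) R0 (fun _ => z) cis cis_bar s Hz); auto.
  - intros t; apply continuous_Cconst.
  - apply continuous_cis.
  - apply continuous_cis_bar.
  - apply Cmod_cis.
  - apply Cmod_cis_bar. }
assert (Path : forall (s t : R), continuous (U := C_UniformSpace) (fun t => z + s * cis t)%C t).
{ intros s t; apply continuous_Cplus; [apply continuous_Cconst|].
  apply continuous_Cmult; [apply continuous_Cconst|apply continuous_cis]. }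
assert (CF : forall z, Cmod (z - c) < R0 -> ccont F z)
  by (intros y Hy; now apply (cderiv_ccont F y (F' y)), HF).
assert (EP : forall s : R, 0 <= s <= r -> P s = (M s * s)%C).
{ intros s Hs.
  assert (C1 : forall t, continuous (U := C_UniformSpace)
    (fun t => F' (z + s * cis t) * (cis t * cis_bar t))%C t).
  { intros t; apply continuous_Cmult.
    - apply continuous_path_comp; [apply Path|].
      apply HF'; eapply Rle_lt_trans; [now apply Disc|exact Hz].
    - apply continuous_Cmult; [apply continuous_cis|apply continuous_cis_bar]. }
  assert (C2 : forall t, continuous (U := C_UniformSpace)
    (fun t => F (z + s * cis t) * cis_bar t)%C t).
  { intros t; apply continuous_Cmult; [|apply continuous_cis_bar].
    apply continuous_path_comp; [apply Path|].
    apply CF; eapply Rle_lt_trans; [now apply Disc|exact Hz]. }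
  assert (I1 := is_RInt_minus _ _ _ _ _ _
    (is_RInt_Cmult_r _ _ _ _ s (is_RInt_oint _ C1)) (is_RInt_oint _ C2)).
  assert (I2 : is_RInt (V := C_R_NormedModule)
    (fun t => minus (F' (z + s * cis t) * (cis t * cis_bar t) * s)%C
                    (F (z + s * cis t) * cis_bar t)%C) 0 (2 * PI) zero).
  (* The second factor is [- i e^(- i t)], so [H] has derivative [s F' - F e^(- i t)] along the
     circle, which is the integrand; [H] is periodic, so the integral vanishes. *)
  { pose (H := fun t => (F (z + s * cis t) * ((- sin t)%R, (- cos t)%R))%C).
    replace (zero : C_R_NormedModule) with (minus (H (2 * PI) : VC) (H 0)).
    2: { unfold H, cis; rewrite sin_2PI, cos_2PI, sin_0, cos_0.
         apply (minus_eq_zero (G := C_R_NormedModule)). }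
    apply (is_RInt_derive (V := VC) H).
    - intros t _.
      assert (D1 : is_derive (V := C_R_NormedModule) (fun t => z + s * cis t)%C t
        (s * ((- sin t)%R, cos t))%C).
      { apply is_derive_ext with
          (fun t => (fst z + s * cos t, snd z + s * sin t) : C).
        - intros x; apply injective_projections; simpl; ring.
        - replace (s * ((- sin t)%R, cos t))%C with ((s * - sin t, s * cos t) : C)
            by (apply injective_projections; simpl; ring).
          apply is_derive_pair; auto_derive; trivial; ring. }
      assert (D2 := is_derive_cderiv_comp F (fun t => z + s * cis t)%C t _ _
        (HF _ (Rle_lt_trans _ _ _ (Disc s t Hs) Hz)) D1).
      assert (D3 : is_derive (V := C_R_NormedModule) (fun t => (- sin t, - cos t) : C) t
        ((- cos t, sin t) : C)).
      { apply is_derive_pair; auto_derive; trivial; ring. }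
      assert (D4 := is_derive_Cmult _ _ _ _ _ D2 D3).
      match goal with |- is_derive _ _ ?v => replace v with
        (F' (z + s * cis t) * (s * ((- sin t)%R, cos t)) * ((- sin t)%R, (- cos t)%R) +
           F (z + s * cis t) * ((- cos t)%R, sin t))%C end; [exact D4|].
      match goal with |- _ = minus ?x ?y => change (minus x y) with (x - y)%C end.
      unfold cis, cis_bar.
      generalize (F' (z + s * (cos t, sin t))%C) (F (z + s * (cos t, sin t))%C).
      intros [a1 a2] [b1 b2]; apply injective_projections; simpl; ring.
    - intros t _; apply (continuous_minus (V := C_R_NormedModule)); [|apply C2].
      apply continuous_Cmult; [apply C1|apply continuous_Cconst]. }
  apply (is_RInt_unique (V := VC)) in I1; apply (is_RInt_unique (V := VC)) in I2.
  assert (I3 := eq_trans (eq_sym I1) I2); clear I1 I2; symmetry in I3.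
  change (RtoC 0 = (M s * s - P s)%C) in I3.
  replace (P s) with (M s * s - (M s * s - P s))%C by ring; rewrite <- I3; ring. }
assert (DR : forall s : R, 0 <= s <= r ->
  is_derive (V := C_R_NormedModule) (fun x : R => P x) s (M s)).
{ intros s Hs.
  apply is_derive_ext with (fun x : R => P (0 + x * 1)%C);
    [intros; f_equal; ring|].
  replace (M s) with (M s * 1)%C by ring.
  apply (is_derive_cderiv_comp P (fun x : R => 0 + x * 1)%C);
    [|apply is_derive_affine].
  replace (0 + s * 1)%C with (RtoC s) by ring; now apply DP. }
assert (E0 : M 0 = ((2 * PI)%R * F' z)%C).
{ unfold M; rewrite <- oint_const; apply oint_ext; intros t.
  rewrite cis_bar_inv; replace (z + 0 * cis t)%C with z by ring; ring. }
(* The statement on degree one is real, hence applied to real and imaginary parts separately. *)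
assert (Er : P r = (r * M 0)%C).
{ apply injective_projections.
  - replace (fst (r * M 0)%C) with (r * fst (M 0)) by (simpl; ring).
    apply (homogeneous_of_degree_one (fun s => fst (P s)) (fun s => fst (M s)) r Hr).
    + intros s Hs; apply is_derive_fst; now apply DR.
    + intros s Hs; rewrite (EP s Hs); simpl; ring.
  - replace (snd (r * M 0)%C) with (r * snd (M 0)) by (simpl; ring).
    apply (homogeneous_of_degree_one (fun s => snd (P s)) (fun s => snd (M s)) r Hr).
    + intros s Hs; apply is_derive_snd; now apply DR.
    + intros s Hs; rewrite (EP s Hs); simpl; ring. }
replace (circle_int F r z) with (P r)
  by (apply oint_ext; intros; do 2 f_equal; ring).
rewrite Er, E0, (RtoC_mult (2 * PI) r); ring.
Qed.

Lemma circle_int_eq' (F F' : C -> C) (c z : C) (r R0 : R) :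
  0 < r -> Cmod (z - c) + r < R0 ->
  (forall z, Cmod (z - c) < R0 -> cderiv F z (F' z)) ->
  (forall z, Cmod (z - c) < R0 -> ccont F' z) ->
  F' z = ((/ (2 * PI * r))%R * circle_int F r z)%C.
Proof.
intros Hr Hz HF HF'; rewrite (circle_int_eq F F' c z r R0) by assumption.
assert (HPI := PI_RGT_0).
assert (Hn : 2 * PI * r <> 0) by (apply Rgt_not_eq; apply Rmult_lt_0_compat; lra).
rewrite Cmult_assoc, <- RtoC_mult, Rinv_l by easy; ring.
Qed.

(** The primitive of [f] has the continuous derivative [f], so [f] is a circle integral of its
    primitive; differentiating under the integral gives [f'] as a circle integral of [f], hence [f']
    is continuous. This permits a second differentiation, now of the integral of [f]. *)
Lemma derivative_cderiv (f f' : C -> C) (c : C) (r : R) :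
  0 < r -> (forall z, Cmod (z - c) < r -> cderiv f z (f' z)) ->
  exists l, cderiv f' c l.
Proof.
intros Hr Hf.
(* The primitive lives on the disc of radius [3 * s < r]. Circles of radius [s] stay in it for
   centres within [2 * s] of [c], and the circle about [c] itself stays within [2 * s], where [f']
   is known to be continuous. *)
pose (s := r / 4).
assert (Cf : forall z, Cmod (z - c) < r -> ccont f z)
  by (intros z Hz; now apply (cderiv_ccont f z (f' z)), Hf).
assert (DG : forall z, Cmod (z - c) < 3 * s -> cderiv (segint f c) z (f z)).
{ apply primitive_disc; intros z Hz; exists (f' z); apply Hf; unfold s in Hz; lra. }
assert (CG : forall z, Cmod (z - c) < 3 * s -> ccont f z).
{ intros z Hz; apply Cf; unfold s in Hz; lra. }
assert (Ef : forall z, Cmod (z - c) < 2 * s ->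
  f' z = ((/ (2 * PI * s))%R * circle_int f s z)%C).
{ intros z Hz.
  apply (cderiv_unique f z); [apply Hf; unfold s in Hz; lra|].
  apply (cderiv_ext_loc (fun w => (/ (2 * PI * s))%R * circle_int (segint f c) s w)%C _ _ _
    (2 * s - Cmod (z - c))); [lra| |].
  - intros w Hw; symmetry.
    apply (circle_int_eq' (segint f c) f c w s (3 * s)); auto; [unfold s; lra|].
    generalize (Cmod_dist_triangle w z c); lra.
  - apply cderiv_scal, (circle_int_cderiv _ _ c z s (3 * s)); auto; [unfold s|]; lra. }
assert (Cf' : forall z, Cmod (z - c) < 2 * s -> ccont f' z).
{ intros z Hz eps He.
  assert (K : ccont (fun w => (/ (2 * PI * s))%R * circle_int f s w)%C z).
  { apply ccont_continuous, continuous_Cmult.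
    - apply (continuous_const (V := C_UniformSpace)).
    - apply ccont_continuous, (circle_int_ccont f c z s (3 * s)); auto; [unfold s|]; lra. }
  destruct (K eps He) as [d [Hd H]].
  exists (Rmin d (2 * s - Cmod (z - c))); split; [apply Rmin_glb_lt; lra|].
  intros w Hw.
  assert (Hw1 := Rlt_le_trans _ _ _ Hw (Rmin_l _ _)).
  assert (Hw2 := Rlt_le_trans _ _ _ Hw (Rmin_r _ _)).
  rewrite (Ef z Hz), (Ef w) by (generalize (Cmod_dist_triangle w z c); lra).
  now apply H. }
assert (Hcc : Cmod (c - c) = 0)
  by (replace (c - c)%C with (RtoC 0) by ring; apply Cmod_0).
eexists.
apply (cderiv_ext_loc (fun w => (/ (2 * PI * s))%R * circle_int f s w)%C _ _ _ s).
- unfold s; lra.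
- intros w Hw; symmetry; apply Ef; unfold s in *; lra.
- apply cderiv_scal, (circle_int_cderiv f f' c c s (2 * s)); auto.
  + unfold s; lra.
  + rewrite Hcc; unfold s; lra.
  + intros z Hz; apply Hf; unfold s in Hz; lra.
Qed.

(** * Real parts of functions of [x + i q y] *)

(** A chosen derivative, unspecified where none exists; being a total operator, it can be
    iterated. *)
Definition cder (f : C -> C) (z : C) : C := epsilon (inhabits (RtoC 0)) (cderiv f z).

Definition holomorphic (W : C -> Prop) (f : C -> C) : Prop :=
  forall z, W z -> exists l, cderiv f z l.

Lemma cder_correct (W : C -> Prop) (f : C -> C) (z : C) :
  holomorphic W f -> W z -> cderiv f z (cder f z).
Proof. intros H Hz; unfold cder; now apply epsilon_spec, H. Qed.

Lemma holomorphic_cder (W : C -> Prop) (f : C -> C) :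
  (forall z, W z -> exists r, 0 < r /\ forall w, Cmod (w - z) < r -> W w) ->
  holomorphic W f -> holomorphic W (cder f).
Proof.
intros HW Hf z Hz; destruct (HW z Hz) as [r [Hr H]].
apply (derivative_cderiv f _ z r Hr).
intros w Hw; now apply (cder_correct W), H.
Qed.

(* The image of [D] under [(x, y) -> x + i q y]. *)
Definition sheared (D : R * R -> Prop) (q : R) (z : C) : Prop := D (fst z, snd z / q).

Definition shear (q x y : R) : C := (x, q * y).

Lemma sheared_shear D q x y : 0 < q -> D (x, y) -> sheared D q (shear q x y).
Proof.
intros Hq H; unfold sheared, shear; simpl.
now replace (q * y / q) with y by (field; lra).
Qed.

Lemma open_box (D : R * R -> Prop) (x y : R) : open D -> D (x, y) ->
  exists d, 0 < d /\ forall u v, Rabs (u - x) < d -> Rabs (v - y) < d -> D (u, v).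
Proof.
intros HD Hxy; destruct (HD (x, y) Hxy) as [d Hd].
exists d; split; [apply cond_pos|]; intros u v Hu Hv.
apply Hd; now split.
Qed.

Lemma sheared_open (D : R * R -> Prop) (q : R) : 0 < q -> open D ->
  forall z, sheared D q z -> exists r, 0 < r /\ forall w, Cmod (w - z) < r -> sheared D q w.
Proof.
intros Hq HD z Hz; destruct (open_box D _ _ HD Hz) as [d [Hd H]].
exists (Rmin d (q * d)); split; [apply Rmin_glb_lt; [easy|now apply Rmult_lt_0_compat]|].
intros w Hw; apply H.
- eapply Rle_lt_trans; [|eapply Rlt_le_trans; [exact Hw|apply Rmin_l]].
  eapply Rle_trans; [apply Rmax_l|apply (Rmax_Cmod (w - z)%C)].
- replace (snd w / q - snd z / q) with ((snd w - snd z) / q) by (field; lra).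
  unfold Rdiv; rewrite Rabs_mult, (Rabs_pos_eq (/ q)) by (left; now apply Rinv_0_lt_compat).
  apply Rmult_lt_reg_r with q; [easy|].
  rewrite Rmult_assoc, Rinv_l, Rmult_1_r, (Rmult_comm d) by lra.
  eapply Rle_lt_trans; [|eapply Rlt_le_trans; [exact Hw|apply Rmin_r]].
  eapply Rle_trans; [apply Rmax_r|apply (Rmax_Cmod (w - z)%C)].
Qed.

Section ShearedSum.

Variables (D : R * R -> Prop) (q1 q2 : R) (A B : nat -> C -> C).
Hypothesis OD : open D.
Hypothesis HA : forall n x y, D (x, y) ->
  cderiv (A n) (shear q1 x y) (A (S n) (shear q1 x y)).
Hypothesis HB : forall n x y, D (x, y) ->
  cderiv (B n) (shear q2 x y) (B (S n) (shear q2 x y)).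

(** Here [A n] and [B n] are successive complex derivatives. The family is closed under partial
    derivatives: each raises [n] by one, and the one in [y] also multiplies [a] by [i q1] and [b] by
    [i q2]. *)
Definition sheared_sum (a b : C) (n : nat) (x y : R) : R :=
  Re (a * A n (shear q1 x y)) + Re (b * B n (shear q2 x y)).

Lemma is_derive_Re_comp (F : C -> C) (g : R -> C) (t : R) (c l dg : C) :
  cderiv F (g t) l -> is_derive (V := C_R_NormedModule) g t dg ->
  is_derive (fun s => Re (c * F (g s))) t (Re (c * dg * l)).
Proof.
intros HF Hg.
replace (c * dg * l)%C with (c * l * dg)%C by ring.
apply is_derive_fst.
apply (is_derive_cderiv_comp (fun w => c * F w)%C); [now apply cderiv_scal|easy].
Qed.

Lemma is_derive_shear_x (q x y : R) :
  is_derive (V := C_R_NormedModule) (fun s => shear q s y) x (RtoC 1).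
Proof. apply is_derive_pair; auto_derive; trivial; ring. Qed.

Lemma is_derive_shear_y (q x y : R) :
  is_derive (V := C_R_NormedModule) (fun s => shear q x s) y (Ci * q)%C.
Proof.
replace (Ci * q)%C with ((0, q) : C) by (apply injective_projections; simpl; ring).
apply is_derive_pair; auto_derive; trivial; ring.
Qed.

Lemma is_derive_sheared_sum_x a b n x y : D (x, y) ->
  is_derive (fun s => sheared_sum a b n s y) x (sheared_sum a b (S n) x y).
Proof.
intros H; apply (is_derive_plus (V := R_NormedModule)).
- replace (Re (a * A (S n) (shear q1 x y))) with (Re (a * 1 * A (S n) (shear q1 x y)))
    by now rewrite Cmult_1_r.
  apply (is_derive_Re_comp (A n) (fun s => shear q1 s y)); [now apply HA|apply is_derive_shear_x].
- replace (Re (b * B (S n) (shear q2 x y))) with (Re (b * 1 * B (S n) (shear q2 x y)))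
    by now rewrite Cmult_1_r.
  apply (is_derive_Re_comp (B n) (fun s => shear q2 s y)); [now apply HB|apply is_derive_shear_x].
Qed.

Lemma is_derive_sheared_sum_y a b n x y : D (x, y) ->
  is_derive (fun s => sheared_sum a b n x s) y
    (sheared_sum (a * (Ci * q1)) (b * (Ci * q2)) (S n) x y).
Proof.
intros H; apply (is_derive_plus (V := R_NormedModule)).
- apply (is_derive_Re_comp (A n) (fun s => shear q1 x s)); [now apply HA|apply is_derive_shear_y].
- apply (is_derive_Re_comp (B n) (fun s => shear q2 x s)); [now apply HB|apply is_derive_shear_y].
Qed.

Lemma continuity_2d_Re_comp (F : C -> C) (q x y : R) (c l : C) :
  cderiv F (shear q x y) l ->
  continuity_2d_pt (fun u v => Re (c * F (shear q u v))) x y.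
Proof.
intros HF; apply continuity_2d_pt_filterlim.
apply cderiv_ccont, ccont_continuous in HF.
assert (K : continuous (T := prod_UniformSpace R_UniformSpace R_UniformSpace)
  (U := C_UniformSpace) (fun z => c * F (shear q (fst z) (snd z)))%C (x, y)).
{ apply continuous_Cmult; [apply (continuous_const (V := C_UniformSpace))|].
  apply (continuous_comp (fun z : R * R => shear q (fst z) (snd z)) F); [|exact HF].
  apply continuous_pair; [apply continuous_fst|].
  apply (continuous_scal_r (V := R_NormedModule)), continuous_snd. }
apply (continuous_comp (fun z : R * R => c * F (shear q (fst z) (snd z)))%C
  (fun z : C => fst z) (x, y) K).
destruct (c * F (shear q (fst (x, y)) (snd (x, y))))%C; apply continuous_fst.
Qed.

(** Induction on the order: near a point of the open set [D], both first partial derivatives are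
    again members of the family. *)
Lemma ex_diff_sheared_sum k : forall a b n x y, D (x, y) ->
  ex_diff_n (sheared_sum a b n) k x y.
Proof.
induction k as [|k IH]; intros a b n x y H.
all: assert (K : continuity_2d_pt (sheared_sum a b n) x y)
  by (apply continuity_2d_pt_plus; eapply continuity_2d_Re_comp; [now apply HA|now apply HB]).
- now split.
- destruct (open_box D x y OD H) as [d [Hd Box]].
  split; [exact K|]; split; [eexists; now apply is_derive_sheared_sum_x|].
  split; [eexists; now apply is_derive_sheared_sum_y|]; split.
  + apply ex_diff_n_ext_loc with (sheared_sum a b (S n)); [|now apply IH].
    exists (mkposreal d Hd); intros u v Hu Hv; symmetry.
    apply is_derive_unique, is_derive_sheared_sum_x; now apply Box.
  + apply ex_diff_n_ext_loc with (sheared_sum (a * (Ci * q1)) (b * (Ci * q2)) (S n));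
      [|now apply IH].
    exists (mkposreal d Hd); intros u v Hu Hv; symmetry.
    apply is_derive_unique, is_derive_sheared_sum_y; now apply Box.
Qed.

(** Allows an identity valid only on [D] to be used under a derivative in [x]. *)
Lemma locally_fiber_x x y (P : R -> R -> Prop) : D (x, y) ->
  (forall u, D (u, y) -> P u y) -> locally x (fun u => P u y).
Proof.
intros H HP; destruct (open_box D x y OD H) as [d [Hd Box]].
exists (mkposreal d Hd); intros u Hu; apply HP, Box; [exact Hu|].
now rewrite Rminus_diag, Rabs_R0.
Qed.

Lemma locally_fiber_y x y (P : R -> R -> Prop) : D (x, y) ->
  (forall v, D (x, v) -> P x v) -> locally y (fun v => P x v).
Proof.
intros H HP; destruct (open_box D x y OD H) as [d [Hd Box]].
exists (mkposreal d Hd); intros v Hv; apply HP, Box; [|exact Hv].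
now rewrite Rminus_diag, Rabs_R0.
Qed.

Lemma Derive_n_sheared_sum_x k : forall a b n x y, D (x, y) ->
  Derive_n (fun s => sheared_sum a b n s y) k x = sheared_sum a b (n + k) x y.
Proof.
induction k as [|k IH]; intros a b n x y H; [now rewrite Nat.add_0_r|].
simpl; rewrite (Derive_ext_loc _ (fun s => sheared_sum a b (n + k) s y)).
- rewrite Nat.add_succ_r; now apply is_derive_unique, is_derive_sheared_sum_x.
- apply (locally_fiber_x x y (fun u v => Derive_n (fun s => sheared_sum a b n s v) k u =
    sheared_sum a b (n + k) u v) H); auto.
Qed.

Lemma Derive_n_sheared_sum_y k : forall a b n x y, D (x, y) ->
  Derive_n (fun s => sheared_sum a b n x s) k y =
  sheared_sum (a * (Ci * q1) ^ k) (b * (Ci * q2) ^ k) (n + k) x y.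
Proof.
induction k as [|k IH]; intros a b n x y H.
- simpl Cpow; now rewrite Nat.add_0_r, !Cmult_1_r.
- simpl Derive_n; rewrite (Derive_ext_loc _
    (fun s => sheared_sum (a * (Ci * q1) ^ k) (b * (Ci * q2) ^ k) (n + k) x s)).
  + rewrite Nat.add_succ_r.
    replace (a * (Ci * q1) ^ S k)%C with (a * (Ci * q1) ^ k * (Ci * q1))%C
      by (simpl Cpow; ring).
    replace (b * (Ci * q2) ^ S k)%C with (b * (Ci * q2) ^ k * (Ci * q2))%C
      by (simpl Cpow; ring).
    now apply is_derive_unique, is_derive_sheared_sum_y.
  + apply (locally_fiber_y x y (fun u v => Derive_n (fun s => sheared_sum a b n u s) k v =
      sheared_sum (a * (Ci * q1) ^ k) (b * (Ci * q2) ^ k) (n + k) u v) H); auto.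
Qed.

(** The [k] inner derivatives in [y] produce the powers of [i q1] and [i q2]; the [j] outer ones in
    [x] only raise the index. *)
Lemma partial_derive_sheared_sum (V : R -> R -> R) a b j k x y :
  (forall x y, D (x, y) -> V x y = sheared_sum a b 0 x y) -> D (x, y) ->
  partial_derive j k V x y =
  sheared_sum (a * (Ci * q1) ^ k) (b * (Ci * q2) ^ k) (k + j) x y.
Proof.
intros HV H; unfold partial_derive.
rewrite (Derive_n_ext_loc _
  (fun s => sheared_sum (a * (Ci * q1) ^ k) (b * (Ci * q2) ^ k) k s y));
  [now apply Derive_n_sheared_sum_x|].
apply (locally_fiber_x x y (fun u v => Derive_n (fun z => V u z) k v =
  sheared_sum (a * (Ci * q1) ^ k) (b * (Ci * q2) ^ k) k u v) H).
intros u Hu.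
rewrite (Derive_n_ext_loc _ (fun z => sheared_sum a b 0 u z));
  [now apply Derive_n_sheared_sum_y|].
now apply (locally_fiber_y u y (fun u v => V u v = sheared_sum a b 0 u v) Hu), HV.
Qed.

End ShearedSum.

(** * Monogenic functions *)

(* The coefficient of [I1] for [s = 1] and of [I2] for [s = -1]. *)
Definition coef (s : R) (u : B0) : C := (fst u + s * snd u)%C.

(** For [s = 1] and [s = -1] these are the two characters of the algebra, as [omega] may be sent to
    either square root of [1]. *)
Lemma coef_Bmul (s : R) (u v : B0) : s * s = 1 ->
  coef s (Bmul u v) = (coef s u * coef s v)%C.
Proof.
intros Hs; unfold coef, Bmul; cbn [fst snd].
assert (E : (RtoC s * s)%C = 1) by now rewrite <- RtoC_mult, Hs.
transitivity (fst u * fst v + s * s * (snd u * snd v) +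
  s * (fst u * snd v + snd u * fst v))%C; [rewrite E|]; ring.
Qed.

(** From [e2 = i ((1 + p) / 2 e + (1 - p) / 2 omega)]; the formula for [q] gives [1] for [s = 1] and
    [p] for [s = -1]. *)
Lemma coef_zeta (s p x y q : R) : q = (1 + p) / 2 + s * ((1 - p) / 2) ->
  coef s (zeta p x y) = shear q x y.
Proof.
intros ->; unfold coef, shear; B0_unfold.
apply injective_projections; simpl; field.
Qed.

Lemma zeta_plus (p x y u v : R) :
  plus (zeta p x y) (zeta p u v) = zeta p (x + u) (y + v).
Proof. B0_ring. Qed.

Lemma coef_minus (s : R) (u v : B0) : coef s (minus u v) = (coef s u - coef s v)%C.
Proof.
unfold coef; B0_unfold; apply injective_projections; simpl; ring.
Qed.

Lemma coef_locally (s : R) (l : B0) (eps : R) : s * s = 1 -> 0 < eps ->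
  locally l (fun u : B0 => Cmod (coef s u - coef s l) <= eps).
Proof.
intros Hs He; assert (H4 : 0 < eps / 4) by lra.
exists (mkposreal _ H4); intros u [Hu1 Hu2].
apply C_NormedModule_mixin_compat2 in Hu1; apply C_NormedModule_mixin_compat2 in Hu2.
change (Cmod (fst u - fst l) < sqrt 2 * (eps / 4)) in Hu1.
change (Cmod (snd u - snd l) < sqrt 2 * (eps / 4)) in Hu2.
assert (S2 : sqrt 2 <= 2)
  by (rewrite <- (sqrt_square 2) at 2 by lra; apply sqrt_le_1; lra).
replace (coef s u - coef s l)%C with ((fst u - fst l) + s * (snd u - snd l))%C
  by (unfold coef; ring).
eapply Rle_trans; [apply Cmod_triangle|].
rewrite Cmod_scal_R.
replace (Rabs s) with 1; [nra|].
rewrite <- sqrt_Rsqr_abs; unfold Rsqr; rewrite Hs; symmetry; apply sqrt_1.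
Qed.

(** A character sends the increment [h] to [w - z] and its inverse to the inverse of [w - z], so it
    turns the difference quotient in the algebra into the ordinary complex one. Every [w - z] comes
    from some [h] in [mu p] of comparable size. *)
Lemma coef_cderiv (p s q : R) (D : R * R -> Prop) (Phi : B0 -> B0) (z : C) :
  0 < p -> 0 < q -> s * s = 1 -> q = (1 + p) / 2 + s * ((1 - p) / 2) ->
  monogenic p D Phi -> sheared D q z ->
  exists l, cderiv (fun w => coef s (Phi (zeta p (fst w) (snd w / q)))) z l.
Proof.
intros Hp Hq Hs Eq HPhi Hz.
destruct (HPhi (zeta p (fst z) (snd z / q))) as [l Hl].
{ now exists (fst z), (snd z / q). }
exists (coef s l); intros eps He.
destruct (Hl _ (coef_locally s l eps Hs He)) as [d Hd].
assert (Hd0 := cond_pos d).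
(* The real coordinates of [h] are the real part of [w - z], zero, and its imaginary part times
   [(1 + p) / 2] or [(1 - p) / 2], over [q]; [K] bounds the last two factors. *)
pose (K := (1 + p) / (2 * q)).
assert (HK : 0 < K) by (apply Rdiv_lt_0_compat; lra).
exists (d / (1 + K)); split; [apply Rdiv_lt_0_compat; lra|].
intros w Hw.
destruct (Ceq_dec w z) as [->|Hwz].
{ match goal with |- Cmod ?x <= _ => replace x with (RtoC 0) by ring end.
  rewrite Cmod_0; apply Rmult_le_pos; [lra|apply Cmod_ge_0]. }
pose (h := zeta p (fst w - fst z) (snd w / q - snd z / q)).
assert (Eh : coef s h = (w - z)%C).
{ unfold h; rewrite (coef_zeta s p _ _ q Eq); unfold shear.
  apply injective_projections; simpl; field; lra. }
assert (Hh0 : h <> zero).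
{ intros E; apply Hwz, Ceq_minus; rewrite <- Eh, E; unfold coef.
  apply injective_projections; simpl; ring. }
assert (Hmu : mu p h) by now eexists _, _.
assert (N1 : Rabs (fst w - fst z) <= Cmod (w - z))
  by (eapply Rle_trans; [apply Rmax_l|apply (Rmax_Cmod (w - z)%C)]).
assert (N2 : Rabs (snd w - snd z) <= Cmod (w - z))
  by (eapply Rle_trans; [apply Rmax_r|apply (Rmax_Cmod (w - z)%C)]).
assert (Hw1 : Cmod (w - z) * (1 + K) < d).
{ apply Rmult_lt_compat_r with (r := 1 + K) in Hw; [|lra].
  replace (d / (1 + K) * (1 + K)) with (pos d) in Hw by (field; lra); exact Hw. }
assert (Hball : ball (zero : B0) d h).
{ assert (Y : forall m, Rabs m <= (1 + p) / 2 -> Rabs ((snd w / q - snd z / q) * m) < d).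
  { intros m Hm.
    replace ((snd w / q - snd z / q) * m) with ((snd w - snd z) * (m / q)) by (field; lra).
    rewrite Rabs_mult.
    assert (Rabs (m / q) <= K).
    { unfold Rdiv, K; rewrite Rabs_mult, (Rabs_pos_eq (/ q))
        by (left; now apply Rinv_0_lt_compat).
      replace ((1 + p) / (2 * q)) with ((1 + p) / 2 * / q) by (field; lra).
      apply Rmult_le_compat_r; [left; now apply Rinv_0_lt_compat|easy]. }
    apply Rle_lt_trans with (Cmod (w - z) * K).
    - apply Rmult_le_compat; try apply Rabs_pos; assumption.
    - generalize (Cmod_ge_0 (w - z)); lra. }
  assert (X : Rabs (fst w - fst z) < d) by (generalize (Cmod_ge_0 (w - z)); nra).
  assert (Rb : forall u : R, Rabs u < d -> ball (0 : R_UniformSpace) d u).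
  { intros u Hu; change (Rabs (u - 0) < d); now rewrite Rminus_0_r. }
  unfold h; B0_unfold; repeat split; apply Rb; cbn [fst snd].
  - match goal with |- Rabs ?u < _ => replace u with (fst w - fst z) by (field; lra) end; exact X.
  - match goal with |- Rabs ?u < _ =>
      replace u with ((snd w / q - snd z / q) * ((1 + p) / 2)) by (field; lra) end.
    apply Y; rewrite Rabs_pos_eq; lra.
  - match goal with |- Rabs ?u < _ => replace u with 0 by (field; lra) end.
    rewrite Rabs_R0; exact Hd0.
  - match goal with |- Rabs ?u < _ =>
      replace u with ((snd w / q - snd z / q) * ((1 - p) / 2)) by (field; lra) end.
    apply Y, Rabs_le; lra. }
specialize (Hd h Hball (conj Hmu Hh0)).
assert (Einv : (coef s h * coef s (Binv h))%C = 1).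
{ rewrite <- coef_Bmul, Bmul_inv_r by (try apply (mu_invertible p); assumption).
  unfold coef, Be; apply injective_projections; simpl; ring. }
assert (Ezh : plus (zeta p (fst z) (snd z / q)) h = zeta p (fst w) (snd w / q)).
{ unfold h; rewrite zeta_plus; f_equal; ring. }
cbv beta in Hd; rewrite Ezh, coef_Bmul, coef_minus in Hd by exact Hs.
rewrite <- Eh.
match goal with |- Cmod (?a - ?b - ?c * ?e) <= _ =>
  replace (a - b - c * e)%C with (((a - b) * coef s (Binv h) - c) * e)%C end.
- rewrite Cmod_mult; apply Rmult_le_compat_r; [apply Cmod_ge_0|exact Hd].
- match goal with |- (((?a - ?b) * ?i - ?c) * ?e)%C = _ =>
    transitivity ((a - b) * (e * i) - c * e)%C end; [ring|rewrite Einv; ring].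
Qed.

(** With [F1], [F2] the two coefficients, [F1 = (U1 + i U2) + i (U3 + i U4)] and
    [F2 = (U1 + i U2) + i p (U3 + i U4)]. Solving gives [U1 + i U2 = (F2 - p F1) / (1 - p)] and
    [U3 + i U4 = i (F2 - F1) / (1 - p)]; imaginary parts are real parts after multiplication by
    [- i]. *)
Lemma real_component_combination (p : R) (D : R * R -> Prop) (Phi : B0 -> B0)
    (U : nat -> R -> R -> R) (k : nat) :
  p <> 1 -> real_components p D Phi U -> (1 <= k <= 4)%nat ->
  exists a b : C, forall x y, D (x, y) ->
    U k x y = Re (a * coef 1 (Phi (zeta p x y))) + Re (b * coef (-1) (Phi (zeta p x y))).
Proof.
intros Hp HU Hk.
assert (Hp' : 1 - p <> 0) by lra.
assert (K : k = 1%nat \/ k = 2%nat \/ k = 3%nat \/ k = 4%nat) by lia.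
destruct K as [-> | [-> | [-> | ->]]].
- exists (- p / (1 - p), 0), (1 / (1 - p), 0); intros x y H; rewrite (HU x y H).
  unfold coef; B0_unfold; field; easy.
- exists (0, p / (1 - p)), (0, - 1 / (1 - p)); intros x y H; rewrite (HU x y H).
  unfold coef; B0_unfold; field; easy.
- exists (0, - 1 / (1 - p)), (0, 1 / (1 - p)); intros x y H; rewrite (HU x y H).
  unfold coef; B0_unfold; field; easy.
- exists (- 1 / (1 - p), 0), (1 / (1 - p), 0); intros x y H; rewrite (HU x y H).
  unfold coef; B0_unfold; field; easy.
Qed.

Theorem mainTheorem1 (p : R) (D : R * R -> Prop) (Phi : B0 -> B0)
    (U : nat -> R -> R -> R) :
  0 < p -> p <> 1 ->
  planar_domain D ->
  monogenic p D Phi ->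
  real_components p D Phi U ->
  forall k : nat, (1 <= k <= 4)%nat ->
  forall x y : R, D (x, y) ->
    ex_diff_n (U k) 4 x y /\
    partial_derive 0 4 (U k) x y
      + (p ^ 2 + 1) * partial_derive 2 2 (U k) x y
      + p ^ 2 * partial_derive 4 0 (U k) x y = 0.
Proof.
intros Hp Hp1 [_ [OD _]] HPhi HU k Hk x y Hxy.
destruct (real_component_combination p D Phi U k Hp1 HU Hk) as [a [b Eab]].
(* The coefficient as a function of [w = x + i q y]; [A] lists its iterated complex derivatives. *)
pose (F := fun s q w => coef s (Phi (zeta p (fst w) (snd w / q)))).
pose (A := fun s q n => Nat.iter n cder (F s q)).
assert (HolA : forall s q, 0 < q -> s * s = 1 -> q = (1 + p) / 2 + s * ((1 - p) / 2) ->
  forall n, holomorphic (sheared D q) (A s q n)).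
{ intros s q Hq Hs Eq n; induction n as [|n IH].
  - intros z Hz; now apply (coef_cderiv p s q D Phi z).
  - apply holomorphic_cder; [now apply sheared_open|exact IH]. }
assert (DA : forall s q, 0 < q -> s * s = 1 -> q = (1 + p) / 2 + s * ((1 - p) / 2) ->
  forall n x y, D (x, y) -> cderiv (A s q n) (shear q x y) (A s q (S n) (shear q x y))).
{ intros s q Hq Hs Eq n u v H; apply (cder_correct (sheared D q)).
  - now apply HolA.
  - now apply sheared_shear. }
assert (HA := DA 1 1 Rlt_0_1 ltac:(ring) ltac:(field)).
assert (HB := DA (-1) p Hp ltac:(ring) ltac:(field)).
assert (EU : forall u v, D (u, v) ->
  U k u v = sheared_sum 1 p (A 1 1) (A (-1) p) a b 0 u v).
{ intros u v H; rewrite (Eab u v H); unfold sheared_sum, A, F, shear; simpl.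
  replace (1 * v / 1) with v by field.
  now replace (p * v / p) with v by (field; lra). }
split.
- apply ex_diff_n_ext_loc with (sheared_sum 1 p (A 1 1) (A (-1) p) a b 0).
  + destruct (open_box D x y OD Hxy) as [d [Hd Box]].
    exists (mkposreal d Hd); intros u v Hu Hv; symmetry; now apply EU, Box.
  + now apply (ex_diff_sheared_sum D).
- rewrite !(partial_derive_sheared_sum D 1 p (A 1 1) (A (-1) p) OD HA HB
    (U k) a b _ _ x y EU Hxy).
  (* All three terms involve the fourth derivatives, with total factor [(i q)^4 + (p^2 + 1) (i q)^2
     + p^2 = (q^2 - 1) (q^2 - p^2)], which vanishes for [q = 1] and for [q = p]. *)
  unfold sheared_sum; simpl Nat.add.
  generalize (A 1 1 4%nat (shear 1 x y)) (A (-1) p 4%nat (shear p x y)).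
  clear; destruct a as [a1 a2], b as [b1 b2]; intros [f1 f2] [g1 g2].
  simpl; ring.
Qed.
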